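(* Let $n\geq 3$ and let $G=\mathrm{D}_{2n}=\langle a,b\mid a^n=b^2=1,\ b^{-1}ab=a^{-1}\rangle$ be the dihedral group of order $2n$. (1) Suppose $G$ has the $m$-DCI property for some integer $m$ with $1\leq m\leq n-1$. Then $n$ is odd; and if moreover $p+1\leq m\leq n-1$ for some prime divisor $p$ of $n$, then a Sylow $p$-subgroup $G_p$ of $G$ is isomorphic to $\mathbb{Z}_p$ (the cyclic group of order $p$). (2) Suppose $n$ is a power of a prime $q$, and let $1\leq m\leq n-1$. Then $G$ has the $m$-DCI property if and only if $q$ is odd and either $n=q$ or $1\leq m\leq q$.
   Context: All groups and digraphs are finite. For a group $G$ and a subset $S\subseteq G$ with $1\notin S$, the Cayley digraph $\mathrm{Cay}(G,S)$ has vertex set $G$ and arc set $\{(g,sg)\mid g\in G,\ s\in S\}$; its out-valency is $|S|$. The subset $S$ (and the digraph $\mathrm{Cay}(G,S)$) is called a CI-subset (CI-digraph) if for every subset $T\subseteq G$ with $1\notin T$ such that $\mathrm{Cay}(G,T)\cong\mathrm{Cay}(G,S)$ as digraphs, there is a group automorphism $\alpha\in\mathrm{Aut}(G)$ with $S^\alpha=T$. For a positive integer $m$, $G$ has the $m$-DCI property if every Cayley digraph $\mathrm{Cay}(G,S)$ of $G$ with $|S|=m$ is a CI-digraph. *)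

(* Defs.v *)
From mathcomp Require Import all_boot all_fingroup all_solvable.
Set Implicit Arguments. Unset Strict Implicit. Unset Printing Implicit Defensive.
Local Open Scope group_scope.

(* The group G is the whole finite group type gT, i.e. G = [set: gT]. *)
(* Cay(G,S) has arcs (g, s g); so (x,y) is an arc iff y * x^-1 \in S.  *)
Definition cayley_arc (gT : finGroupType) (S : {set gT}) (x y : gT) : bool :=
  y * x^-1 \in S.

Definition cayley_iso (gT : finGroupType) (S T : {set gT}) : Prop :=
  exists f : {perm gT}, forall x y : gT,
    cayley_arc S x y = cayley_arc T (f x) (f y).

Definition CI_subset (gT : finGroupType) (S : {set gT}) : Prop :=
  forall T : {set gT}, 1 \notin T -> cayley_iso S T ->
    exists2 a : {perm gT}, a \in Aut [set: gT] & a @: S = T.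

Definition has_DCI (gT : finGroupType) (m : nat) : Prop :=
  forall S : {set gT}, 1 \notin S -> #|S| = m -> CI_subset S.

(* Main.v *)
Require Import Defs.
From mathcomp Require Import all_boot all_fingroup all_solvable all_algebra.
From mathcomp Require Import zify.
Set Implicit Arguments. Unset Strict Implicit. Unset Printing Implicit Defensive.
Local Open Scope group_scope.

(** Let [A] be the cyclic part of the dihedral group.

    Sufficiency ([q] odd, [n] a power of [q], [m <= q]).  One reduces to connection sets
    that generate the group.  If the right translations by [A] form a Sylow q-subgroup of
    the automorphism group of Cay(G,S), an isomorphism Cay(G,S) -> Cay(G,T) can be corrected
    by Sylow's theorem so as to normalise them and to fix 1, and it is then a group
    automorphism.  Otherwise a larger q-group [P] of automorphisms has a point stabiliser
    acting as a q-cycle on the out-neighbours of some vertex; as [P] respects the cosets of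
    the subgroups of [A], such a q-cycle has the form x |-> x^l * mu with l = 1 mod q on the
    cyclic subgroup [H] generated by the differences of [S], and q iterations of it from 1
    give mu^(q + q^2 t).  Hence [H] has order [q], [S] is a coset of [H], so is [T], and
    cosets of [H] are matched by an explicit automorphism.

    Necessity.  If [n] is even, a symmetric [S] in [A] has an isomorphic copy inside the
    dihedral subgroup of index 2, which is not contained in [A].  If [p^2] divides [n], let
    [z] in [A] have order [p] and [Z = <z>]: squaring the Z-part of every vertex is an
    isomorphism from [{z}, aZ, ...] to [{z^2, aZ, ...}], whereas an automorphism that
    preserves [aZ] fixes [z]. *)


(** * Generation, and intermediate subgroups of p-groups *)

Lemma gen_subset_lmul (gT : finGroupType) (A X : {set gT}) :
    1 \in X -> (forall s x, s \in A -> x \in X -> s * x \in X) ->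
  <<A>> \subset X.
Proof.
move=> X1 XM; apply/subsetP=> _ /gen_prodgP[n [c Ac ->]].
elim: n c Ac => [|n IHn] c Ac; first by rewrite big_ord0.
by rewrite big_ord_recl XM ?Ac ?IHn.
Qed.

(** Descent from [P] through maximal subgroups containing [Q]: each has index [p] in the previous
    one, so every order between [#|Q|] and [#|P|] is met. *)
Lemma pgroup_between (gT : finGroupType) (p d : nat) (Q P : {group gT}) :
    p.-group P -> Q \subset P -> #|Q| %| d -> d %| #|P| ->
  exists B : {group gT}, [/\ Q \subset B, B \subset P & #|B| = d].
Proof.
have [k] := ubnP #|P|; elim: k P => // k IHk P ltPk pP sQP dvQd dvdP.
have [->|d_neqP] := eqVneq d #|P|; first by exists P.
have [eqQP | [M maxM sQM]] := maximal_exists sQP.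
  by case/eqP: d_neqP; apply/eqP; rewrite eqn_dvd dvdP -eqQP.
have [ntP|] := eqVneq #|P| 1%N.
  by move: dvdP d_neqP; rewrite ntP dvdn1 => ->.
rewrite -trivg_card1 => ntP; have [p_pr _ [e oP]] := pgroup_pdiv pP ntP.
have ltMP := maxgroupp maxM; have sMP := proper_sub ltMP.
have oM : #|M| = (p ^ e)%N.
  apply/eqP; rewrite -(eqn_pmul2r (prime_gt0 p_pr)) -{1}(p_maximal_index pP maxM).
  by rewrite Lagrange // oP expnSr.
have dvdM : d %| #|M|.
  move: dvdP d_neqP; rewrite oP oM => /(dvdn_pfactor _ _ p_pr)[i lei ->] neq.
  apply: dvdn_exp2l; rewrite leqNgt; apply: contra neq => lt_ei.
  by apply/eqP; congr (_ ^ _)%N; apply/eqP; rewrite eqn_leq lei.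
have [|B [sQB sBM oB]] := IHk M _ (pgroupS sMP pP) sQM dvQd dvdM.
  by apply: leq_trans (proper_card ltMP) _; rewrite -ltnS.
by exists B; split=> //; apply: subset_trans sMP.
Qed.

(** * Right translations and the automorphism group of a Cayley digraph *)

Section RightTranslations.

Variable gT : finGroupType.

Definition rtrans (c : gT) : {perm gT} := perm (mulIg c).

Lemma rtransE c x : rtrans c x = x * c. Proof. exact: permE. Qed.

Lemma rtransM : {in [set: gT] &, {morph rtrans : c d / c * d}}.
Proof. by move=> c d _ _; apply/permP=> x; rewrite permM !rtransE mulgA. Qed.

Canonical rtrans_morphism := Morphism rtransM.

Lemma rtrans_inj : injective rtrans.
Proof.
by move=> c d /(congr1 (fun s : {perm gT} => s 1)); rewrite !rtransE !mul1g.
Qed.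

Lemma card_rtrans (C : {group gT}) : #|rtrans @* C| = #|C|.
Proof. by rewrite card_injm ?subsetT //; apply/injmP=> x y _ _; apply: rtrans_inj. Qed.

Lemma mem_rtrans (C : {group gT}) c : (rtrans c \in rtrans @* C) = (c \in C).
Proof.
apply/idP/idP=> [/morphimP[d _ Cd /rtrans_inj->] //|]; exact: mem_morphim.
Qed.

End RightTranslations.

Arguments rtrans {gT} c.

Section CayleyAut.

Variables (gT : finGroupType) (S : {set gT}).

Definition cayley_aut : {set {perm gT}} :=
  [set f : {perm gT} |
     [forall x, forall y, cayley_arc S x y == cayley_arc S (f x) (f y)]].

Lemma cayley_autP (f : {perm gT}) :
  reflect (forall x y, cayley_arc S x y = cayley_arc S (f x) (f y))
          (f \in cayley_aut).
Proof. by rewrite inE; apply: (iffP 'forall_'forall_eqP). Qed.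

Lemma cayley_aut_group_set : group_set cayley_aut.
Proof.
apply/group_setP; split=> [|f g /cayley_autP fA /cayley_autP gA].
  by apply/cayley_autP=> x y; rewrite !perm1.
by apply/cayley_autP=> x y; rewrite !permM -gA -fA.
Qed.

Canonical cayley_aut_group := Group cayley_aut_group_set.

Lemma rtrans_arc (c x y : gT) :
  cayley_arc S (x * c) (y * c) = cayley_arc S x y.
Proof. by rewrite /cayley_arc invMg mulgA mulgK. Qed.

Lemma rtrans_cayley_aut (C : {group gT}) : rtrans @* C \subset cayley_aut.
Proof.
apply/subsetP=> _ /morphimP[c _ _ ->]; apply/cayley_autP=> x y.
by rewrite !rtransE rtrans_arc.
Qed.

End CayleyAut.

(** * Blocks of a p-group containing the translations by a cyclic group *)

Section PBlocks.

Variables (gT : finGroupType) (q : nat) (C : {group gT}) (P : {group {perm gT}}).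
Hypotheses (cycC : cyclic C) (pP : q.-group P) (sCP : rtrans @* C \subset P).
Variable x : gT.
Hypothesis orbP : orbit 'P P x = x *: C.

Let Px : {group {perm gT}} := ('C_P[x | 'P])%G.

(** [H] consists of the [c] in [C] whose translation lies in [B]. An element of [B] taking [x] to
    [x * c] differs from the translation by [c] only by an element of the stabiliser of [x], which
    lies in [B] already. *)
Lemma block_orbit (B : {group {perm gT}}) : Px \subset B -> B \subset P ->
  exists H : {group gT},
    [/\ H \subset C, orbit 'P B x = x *: H, rtrans @* H \subset B
       & #|B| = (#|H| * #|Px|)%N].
Proof.
move=> sPxB sBP; pose H : {group gT} := (C :&: rtrans @*^-1 B)%G.
have orbB : orbit 'P B x = x *: H.
  apply/setP=> y; apply/orbitP/lcosetP=> [[b Bb <-]|[c]].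
    have: 'P%act x b \in x *: C by rewrite -orbP mem_orbit ?(subsetP sBP).
    case/lcosetP=> c Cc bx; exists c; rewrite // inE Cc mem_morphpre ?inE //=.
    have Pxb: b * rtrans c^-1 \in Px.
      rewrite inE; apply/andP; split.
        by rewrite (groupM (subsetP sBP b Bb)) // (subsetP sCP) // mem_rtrans groupV.
      apply/astab1P; rewrite /= /aperm permM rtransE.
      by move: bx; rewrite /= /aperm => ->; rewrite mulgK.
    have := subsetP sPxB _ Pxb; rewrite groupMl // => Bc.
    by rewrite -groupV -morphV ?inE.
  case/setIP=> Cc /morphpreP[_ Bc] ->.
  by exists (rtrans c); rewrite //= /aperm rtransE.
exists H; split; first exact: subsetIl.
- exact: orbB.
- by apply/subsetP=> _ /morphimP[c _ /setIP[_ /morphpreP[_ Bc]] ->].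
rewrite -(card_orbit_in_stab 'P x (subsetT B)) orbB card_lcoset; congr (_ * _)%N.
congr #|pred_of_set _|; apply/setP=> g; rewrite !inE.
apply/andP/andP=> [[Bg gx]|[Pg gx]]; split=> //; first exact: (subsetP sBP).
by rewrite (subsetP sPxB) // !inE Pg.
Qed.

(* In a p-group the stabiliser of x extends to a chain of subgroups, each normal *)
(* of index p in the next; their orbits on xC are the cosets of subgroups of C. *)
Lemma pgroup_block (H M : {group gT}) :
    H \subset C -> M \subset H -> prime #|H : M| ->
  forall g h, g \in P -> h \in H -> h^-1 * ((g x)^-1 * g (x * h)) \in M.
Proof.
move=> sHC sMH pr_HM g h Pg Hh.
have sMC := subset_trans sMH sHC.
have stabP : #|P| = (#|C| * #|Px|)%N.
  by rewrite -(card_orbit_in_stab 'P x (subsetT P)) orbP card_lcoset.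
have [||B1 [sPxB1 sB1P oB1]] := @pgroup_between _ q (#|H| * #|Px|) Px P pP (subsetIl _ _).
- exact: dvdn_mull.
- by rewrite stabP dvdn_mul ?cardSg.
have pB1 := pgroupS sB1P pP.
have [||B2 [sPxB2 sB21 oB2]] := @pgroup_between _ q (#|M| * #|Px|) Px B1 pB1 sPxB1.
- exact: dvdn_mull.
- by rewrite oB1 dvdn_mul ?cardSg.
have sB2P := subset_trans sB21 sB1P.
have Px_gt0 : 0 < #|Px| by apply: cardG_gt0.
have indB : #|B1 : B2| = #|H : M|.
  rewrite -(divgS sB21) -(divgS sMH) oB1 oB2 divnMr //.
have nB21 : B2 <| B1.
  by apply: (p_maximal_normal pB1); apply: p_index_maximal; rewrite ?indB.
have [H1 [sH1C _ sHB1 oH1]] := block_orbit sPxB1 sB1P.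
have [M1 [sM1C orbB2 _ oM1]] := block_orbit sPxB2 sB2P.
have defH : H1 :=: H.
  apply/eqP; rewrite (eq_subG_cyclic cycC) //.
  by rewrite -(eqn_pmul2r Px_gt0) -oH1 oB1.
have defM : M1 :=: M.
  apply/eqP; rewrite (eq_subG_cyclic cycC) //.
  by rewrite -(eqn_pmul2r Px_gt0) -oM1 oB2.
(* First the case of [k] fixing [x]: conjugating [k] by the translation by [h] stays in [B2], which
   is normal in [B1], so it moves [x] inside [x *: M]. *)
have fix_case k : k \in Px -> h^-1 * (x^-1 * k (x * h)) \in M.
  move=> Pxk; have Bk := subsetP sPxB2 _ Pxk.
  have Bh : rtrans h \in B1 by rewrite (subsetP sHB1) // mem_rtrans defH.
  have: rtrans h * k * (rtrans h)^-1 \in B2.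
    have := memJ_norm k (subsetP (normal_norm nB21) _ (groupVr Bh)).
    by rewrite Bk conjgE invgK mulgA.
  move=> Bhk; have: 'P%act x (rtrans h * k * (rtrans h)^-1) \in x *: M.
    by rewrite -defM -orbB2 mem_orbit.
  rewrite /= /aperm -[(rtrans h)^-1]morphV ?inE //= !permM !rtransE.
  case/lcosetP=> m Mm /(canRL (mulgK _)); rewrite invgK => ->.
  have cCC : abelian C := cyclic_abelian cycC.
  have Cm := subsetP sMC _ Mm; have Ch := subsetP sHC _ Hh.
  by rewrite -!mulgA mulKg (centsP cCC m Cm h Ch) mulKg.
have: 'P%act x g \in x *: C by rewrite -orbP mem_orbit.
rewrite /= /aperm => /lcosetP[c Cc gx].
(* The general case follows by composing [g] with the translation that brings [g x] back to [x]. *)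
have Pxg : g * rtrans c^-1 \in Px.
  rewrite inE; apply/andP; split.
    by rewrite groupM // (subsetP sCP) // mem_rtrans groupV.
  by apply/astab1P; rewrite /= /aperm permM rtransE gx mulgK.
have := fix_case _ Pxg; rewrite permM rtransE gx => Mg.
have cCC : abelian C := cyclic_abelian cycC.
rewrite (_ : _ * _ = h^-1 * (x^-1 * (g (x * h) * c^-1))) //.
have: g (x * h) * c^-1 = x * h * (h^-1 * (x^-1 * (g (x * h) * c^-1))).
  by rewrite !mulgA mulgK mulgV mul1g.
set m := h^-1 * (x^-1 * _) in Mg *; move/(canRL (mulgKV _)) => ->.
move: (m) Mg => {}m Mg.
have Cm := subsetP sMC _ Mg; have Ch := subsetP sHC _ Hh.
rewrite invMg -!mulgA mulKg (centsP cCC m Cm c Cc) (mulgA h) (centsP cCC h Ch c Cc).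
by rewrite -!mulgA mulKg mulKg.
Qed.

End PBlocks.


(** * Groups dihedral over a cyclic subgroup *)

(** The case where [C] is the whole group is allowed, so that the notion passes to arbitrary
    subgroups, cyclic or dihedral; the reduction to generating connection sets relies on this. *)
Definition dihedral_over (gT : finGroupType) (C : {group gT}) : Prop :=
  [/\ cyclic C, forall x, x \notin C -> x * x = 1
    & forall x y, x \notin C -> y \notin C -> x * y \in C].

Section DihedralOver.

Variables (gT : finGroupType) (C : {group gT}).
Hypothesis dihC : dihedral_over C.

Lemma dih_abelian : {in C &, commutative mulg}.
Proof.
case: dihC => /cyclic_abelian/centsP cCC _ _ x y Cx Cy; exact: cCC.
Qed.

Lemma dih_inv x : x \notin C -> x^-1 = x.
Proof. by case: dihC => _ sq1 _ /sq1/eqP; rewrite -eq_invg_mul => /eqP. Qed.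

Lemma dih_mulC x c : x \notin C -> c \in C -> c * x = x * c^-1.
Proof.
move=> nCx Cc; have: x * c^-1 \notin C by rewrite groupMr ?groupV.
by move/dih_inv; rewrite invMg invgK (dih_inv nCx).
Qed.

Lemma dih_norm x (H : {group gT}) : H \subset C -> x \in 'N(H).
Proof.
move=> sHC; rewrite inE; apply/subsetP=> _ /imsetP[c Hc ->].
have Cc := subsetP sHC _ Hc; rewrite conjgE.
have [Cx|nCx] := boolP (x \in C); first by rewrite (dih_abelian Cc Cx) mulKg.
by rewrite (dih_mulC nCx Cc) mulKg groupV.
Qed.

Lemma dih_outer_mem x y : x \notin C -> (y \notin C) = (x * y \in C).
Proof.
move=> nCx; apply/idP/idP=> [nCy|Cxy]; first by case: dihC => _ _; apply.
by apply: contra nCx => Cy; rewrite -(groupMr x Cy).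
Qed.

Lemma dih_odd_order_mem x : odd #[x] -> x \in C.
Proof.
move=> odd_x; apply: contraLR odd_x => nCx; case: dihC => _ sq1 _.
have: #[x] %| 2 by rewrite order_dvdn expgS expg1 sq1.
rewrite dvdn_divisors // !inE => /orP[/eqP ox|/eqP-> //].
by move: nCx; rewrite (eqP (etrans (esym (order_eq1 x)) (introT eqP ox))) group1.
Qed.

(* The hypotheses say that h normalises the translations by C; multiplicativity *)
(* is automatic because the elements outside C are inverting involutions.       *)
Lemma dih_normalising_aut (h : {perm gT}) :
    h 1 = 1 -> (forall c, c \in C -> h c \in C) ->
    (forall x c, c \in C -> h (x * c) = h x * h c) ->
  h \in Aut [set: gT].
Proof.
move=> h1 hC hM.
have hV c : c \in C -> h c^-1 = (h c)^-1.
  move=> Cc; apply: (mulgI (h c)); rewrite -hM ?groupV // !mulgV; exact: h1.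
have hCE : [set h x | x in C] = C.
  apply/eqP; rewrite eqEcard card_imset ?leqnn ?andbT; last exact: perm_inj.
  by apply/subsetP=> _ /imsetP[c Cc ->]; apply: hC.
have hnC x : x \notin C -> h x \notin C.
  by rewrite -{2}hCE mem_imset //; apply: perm_inj.
rewrite inE; apply/andP; split; first by apply/subsetP=> x; rewrite inE.
apply/morphicP=> x y _ _; have [Cy|nCy] := boolP (y \in C); first exact: hM.
have [Cx|nCx] := boolP (x \in C).
  by rewrite (dih_mulC nCy Cx) hM ?groupV // hV // [RHS]dih_mulC ?hnC ?hC.
have [_ sq1 outM] := dihC; have Cd : y * x \in C by apply: outM.
have defx : x = y * (y * x) by rewrite mulgA sq1 ?mul1g.
have -> : h x = h y * h (y * x) by rewrite -hM // -defx.
rewrite -mulgA (dih_mulC (hnC _ nCy) (hC _ Cd)) mulgA sq1 ?hnC // mul1g -hV //.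
by congr (h _); rewrite invMg !dih_inv.
Qed.

End DihedralOver.

Lemma rtransJ_eq (gT : finGroupType) (f : {perm gT}) (c d x : gT) :
  rtrans c ^ f = rtrans d -> f (x * c) = f x * d.
Proof.
by move=> eq_cd; rewrite -[x * c]rtransE -[f x * d]rtransE -eq_cd conjgE !permM permK.
Qed.

(** * The case where the translations form a Sylow subgroup *)

Section NormalisingIso.

Variables (gT : finGroupType) (C : {group gT}) (q : nat) (S T : {set gT}).
Hypotheses (dihC : dihedral_over C) (pC : q.-group C).

(** Babai's argument: the translations pulled back along the isomorphism [f] form a q-group of
    automorphisms of Cay(G,S), so some automorphism [g] conjugates them onto the translations;
    [g * f] is then an isomorphism normalising the translations. *)
Lemma Sylow_cayley_aut_equiv :
    q.-Sylow(cayley_aut S) (rtrans @* C) -> cayley_iso S T ->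
  exists2 a : {perm gT}, a \in Aut [set: gT] & a @: S = T.
Proof.
move=> sylC [f fST].
have sBA : (rtrans @* C) :^ f^-1 \subset cayley_aut S.
  apply/subsetP=> _ /imsetP[_ /morphimP[c _ Cc ->] ->].
  apply/cayley_autP=> x y; rewrite conjgE invgK !permM fST.
  by rewrite [RHS]fST !permKV !rtransE rtrans_arc.
have pB : q.-group ((rtrans @* C) :^ f^-1) by rewrite pgroupJ morphim_pgroup.
have [g Ag sBg] := Sylow_subJ sylC sBA pB.
pose h0 := g * f; pose h := h0 * rtrans (h0 1)^-1.
have hE x : h x = h0 x * (h0 1)^-1 by rewrite permM rtransE.
have h1 : h 1 = 1 by rewrite hE mulgV.
have h_arc x y : cayley_arc S x y = cayley_arc T (h x) (h y).
  by rewrite !hE rtrans_arc !permM -fST; apply/cayley_autP.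
have normE c : c \in C -> exists2 d, d \in C & forall x, h (x * c) = h x * d.
  move=> Cc.
  have defBg : (rtrans @* C) :^ f^-1 = (rtrans @* C) :^ g.
    by apply/eqP; rewrite eqEcard sBg !cardJg leqnn.
  have: rtrans c ^ h0 \in rtrans @* C.
    by rewrite conjgM -mem_conjgV defBg memJ_conjg mem_rtrans.
  (* Composing with a translation to fix 1 conjugates the increment [d], which remains in [C]
     because [C] is normal. *)
  case/morphimP=> d _ Cd def_d; exists (d ^ (h0 1)^-1).
    by rewrite memJ_norm // (dih_norm dihC).
  move=> x; rewrite !hE (rtransJ_eq _ def_d).
  by rewrite conjgE invgK !mulgA mulgKV.
have hC c : c \in C -> h c \in C.
  by case/normE=> d Cd hd; rewrite -[c]mul1g hd h1 mul1g.
exists h.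
  apply: (dih_normalising_aut dihC) => // x c /normE[d Cd hd].
  by rewrite hd -[X in _ = _ * h X]mul1g hd h1 mul1g.
apply/setP=> y; apply/imsetP/idP=> [[s Ss ->]|Ty].
  by have := h_arc 1 s; rewrite h1 /cayley_arc !invg1 !mulg1 Ss => <-.
exists (h^-1 y); last by rewrite permKV.
by have := h_arc 1 (h^-1 y); rewrite h1 permKV /cayley_arc !invg1 !mulg1 Ty.
Qed.

End NormalisingIso.


(** * The case of a larger q-group of automorphisms *)

(** Modulo q^2 the power (1 + qk)^i is 1 + iqk, and summing over i < j gives j + qk C(j,2); [t]
    collects the rest. *)
Lemma affine_iter_mod (q k j : nat) :
  exists t, iter j (fun s => (1 + q * k) * s + 1)%N 0%N
            = (j + q * k * 'C(j, 2) + q * q * t)%N.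
Proof.
elim: j => [|j [t IHj]]; first by exists 0%N; rewrite bin0n /= !muln0.
exists (k * k * 'C(j, 2) + t * (1 + q * k))%N; rewrite iterS IHj binS bin1.
lia.
Qed.

(** For odd [q] the prime divides C(q,2), so the q-th iterate is congruent to q modulo q^2. *)
Lemma affine_iter_ndvd (q k : nat) : prime q -> odd q ->
  ~~ (q ^ 2 %| iter q (fun s => (1 + q * k) * s + 1)%N 0%N).
Proof.
move=> q_pr q_odd; have [t ->] := affine_iter_mod q k q.
have q_gt2 : 2 < q by rewrite odd_prime_gt2.
have /dvdnP[r ->] : q %| 'C(q, 2) by rewrite prime_dvd_bin.
have -> : (q + q * k * (r * q) + q * q * t = q + q ^ 2 * (k * r + t))%N.
  by rewrite -mulnn; lia.
rewrite dvdn_addl; last exact: dvdn_mulr.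
by apply/negP=> /(dvdn_leq (prime_gt0 q_pr)); rewrite -mulnn; nia.
Qed.

Section LargeSylow.

Variables (gT : finGroupType) (q : nat) (C : {group gT}) (S : {set gT}).
Variable P : {group {perm gT}}.
Hypotheses (q_pr : prime q) (q_odd : odd q).
Hypotheses (dihC : dihedral_over C) (pC : q.-group C).
Hypotheses (genS : <<S>> = [set: gT]) (leSq : #|S| <= q).
Hypotheses (sPA : P \subset cayley_aut S) (pP : q.-group P).
Hypotheses (sCP : rtrans @* C \subset P) (ltCP : #|C| < #|P|).

(** An orbit is a union of left cosets of [C], of which there are at most two. Two would give an
    orbit of even size, impossible for a q-group with [q] odd. *)
Lemma pgroup_orbit_coset x : orbit 'P P x = x *: C.
Proof.
have sub y : y \in orbit 'P P x -> y *: C \subset orbit 'P P x.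
  move=> xPy; apply/subsetP=> _ /lcosetP[c Cc ->].
  rewrite -(orbit_in_eqP (subsetT P) xPy); apply/orbitP; exists (rtrans c).
    by rewrite (subsetP sCP) // mem_rtrans.
  by rewrite /= /aperm rtransE.
apply/eqP; rewrite eqEsubset (sub x) ?orbit_refl // andbT.
apply/subsetP=> y xPy; apply: contraT => nCy.
have defO : orbit 'P P x = x *: C :|: y *: C.
  apply/eqP; rewrite eqEsubset subUset (sub x) ?orbit_refl // (sub y) // !andbT.
  apply/subsetP=> z _; rewrite inE !mem_lcoset; apply/orP.
  have [Cz|nCz] := boolP (x^-1 * z \in C); [by left | right].
  rewrite mem_lcoset in nCy.
  have [_ _ outM] := dihC.
  have := outM (x^-1 * y)^-1 (x^-1 * z); rewrite groupV invMg invgK -mulgA mulKVg.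
  exact.
have: #|orbit 'P P x| %| #|P| by apply: dvdn_orbit.
have -> : #|orbit 'P P x| = (2 * #|C|)%N.
  rewrite defO cardsU !card_lcoset (_ : _ :&: _ = set0) ?cards0 ?subn0 ?mul2n ?addnn //.
  apply/setP=> z; rewrite in_setI !inE !mem_lcoset; apply/negP=> /andP[Cxz Cyz].
  move: nCy; rewrite mem_lcoset -(mulgK (y^-1 * z) (x^-1 * y)) groupMr ?groupV //.
  by rewrite -mulgA mulKVg Cxz.
have [e ->] := p_natP pP; move=> /(dvdn_trans (dvdn_mulr _ (dvdnn 2))).
by rewrite dvdn2 oddX q_odd orbT.
Qed.

(** If point stabilisers fixed all out-neighbours, connectedness would make them trivial, and [P]
    would have only [#|C|] elements. *)
Lemma pgroup_moves_arc :
  [exists v, exists s in S, exists g in 'C_P[v | 'P], g (s * v) != s * v].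
Proof.
apply: contraLR ltCP => no_move; rewrite -leqNgt.
have fixP v s g : g \in 'C_P[v | 'P] -> s \in S -> g (s * v) = s * v.
  move=> Pg Ss; apply/eqP; apply: contraR no_move => gsv.
  apply/existsP; exists v; apply/exists_inP; exists s => //.
  by apply/exists_inP; exists g.
rewrite -(card_orbit_in_stab 'P 1 (subsetT P)) pgroup_orbit_coset card_lcoset.
suff -> : 'C_P[1 | 'P] = 1 by rewrite cards1 muln1.
apply/trivgP/subsetP=> g /setIP[Pg /astab1P /= g1]; rewrite inE; apply/eqP/permP=> x.
have: <<S>> \subset [set x | g x == x].
  apply: gen_subset_lmul => [|s y Ss]; first by rewrite inE -{2}g1.
  rewrite !inE => /eqP gy; apply/eqP; apply: fixP => //.
  by rewrite inE Pg; apply/astab1P.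
by rewrite genS => /subsetP/(_ x (in_setT _)); rewrite inE perm1 => /eqP.
Qed.

(** An automorphism [g] fixes [v] and moves its out-neighbour [w]. The arcs from [v *: H] to
    [w *: H] tie its actions on these two cosets together so tightly that, in the coordinate on
    [w *: H], it is affine. *)
Lemma large_Sylow_coset :
  exists Z : {group gT}, exists s, [/\ Z \subset C, #|Z| = q & S = s *: Z].
Proof.
have [/existsP[v /exists_inP[s0 Ss0 /exists_inP[g Pvg]]]] := pgroup_moves_arc.
have : s0 * v \in S :* v by rewrite mem_rcoset mulgK.
move: {s0 Ss0}(s0 * v) => w Svw gw.
have [/cyclic_abelian/centsP cCC _ _] := dihC.
have cycC : cyclic C by case: dihC.
have arcP f x y : f \in P -> cayley_arc S x y -> cayley_arc S (f x) (f y).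
  by move=> Pf; have /cayley_autP <- := subsetP sPA _ Pf.
have stabP f : f \in 'C_P[v | 'P] -> f \in P /\ f v = v.
  by case/setIP=> Pf /astab1P.
have stabS f y : f \in 'C_P[v | 'P] -> y \in S :* v -> f y \in S :* v.
  case/stabP=> Pf fv; rewrite !mem_rcoset => Sy.
  by have := arcP f v y Pf Sy; rewrite fv.
(* The orbit of [w] has q-power size and is not a single point; since [#|S| <= q], it fills all of
   [S :* v]. *)
have le_q_orb : q <= #|orbit 'P 'C_P[v | 'P] w|.
  have: #|orbit 'P 'C_P[v | 'P] w| %| #|'C_P[v | 'P]| by apply: dvdn_orbit.
  have /p_natP[e ->] : q.-group 'C_P[v | 'P] by apply: pgroupS pP; apply: subsetIl.
  case/(dvdn_pfactor _ _ q_pr)=> [] [|i] _ oO.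
    case/negP: gw; have: g w \in orbit 'P 'C_P[v | 'P] w.
      by apply/orbitP; exists g.
    move/eqP: oO; rewrite expn0 => /cards1P[y defO].
    have: w \in orbit 'P 'C_P[v | 'P] w by apply: orbit_refl.
    by rewrite !defO !inE => /eqP-> /eqP->.
  by rewrite oO expnS leq_pmulr // expn_gt0 prime_gt0.
have orbw : orbit 'P 'C_P[v | 'P] w = S :* v.
  apply/eqP; rewrite eqEcard card_rcoset (leq_trans leSq) // andbT.
  by apply/subsetP=> _ /orbitP[f Pvf <-]; apply: stabS.
have oS : #|S| = q.
  by apply/eqP; rewrite eqn_leq leSq -(card_rcoset S v) -orbw.
(* [E] describes the out-neighbours of [v] relative to [w]: [S :* v] is [w *: E], and [E] lies in
   [C] since the orbit of [w] under [P] is [w *: C]. *)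
pose E := [set e in C | w * e \in S :* v].
have SvE e : w * e \in S :* v -> e \in E.
  move=> Sve; rewrite inE Sve andbT.
  have: w * e \in orbit 'P 'C_P[v | 'P] w by rewrite orbw.
  case/orbitP=> f /stabP[Pf _] fw.
  have: w * e \in orbit 'P P w by rewrite -fw mem_orbit.
  by rewrite pgroup_orbit_coset mem_lcoset mulKg.
have oE : #|E| = q.
  rewrite -oS -(card_rcoset S v) -(card_lcoset E w); congr #|pred_of_set _|.
  apply/setP=> y; rewrite mem_lcoset; apply/idP/idP.
    by rewrite inE mulKVg => /andP[].
  by move=> Sy; apply: SvE; rewrite mulKVg.
have EC : E \subset C by apply/subsetP=> e; rewrite inE => /andP[].
have ES e : e \in E -> w * e \in S :* v by rewrite inE => /andP[].
have E1 : 1 \in E by apply: SvE; rewrite mulg1.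
pose H := <<E>>%G.
have sHC : H \subset C by rewrite gen_subG.
have sEH : E \subset H by apply: subset_gen.
have CH h : h \in H -> h \in C by apply: subsetP.
have ntH : (1%G : {group gT}) \proper H.
  rewrite properEcard sub1G cards1 (leq_trans _ (subset_leq_card sEH)) //.
  by rewrite oE prime_gt1.
have pH : q.-group H by apply: pgroupS pC.
have [/= eq1H|[M maxM _]] := maximal_exists (proper_sub ntH).
  by case/eqP: (proper_neq ntH).
have sMH : M \subset H := proper_sub (maxgroupp maxM).
have iMH : #|H : M| = q := p_maximal_index pH maxM.
have block f x h : f \in P -> h \in H -> h^-1 * ((f x)^-1 * f (x * h)) \in M.
  apply: (pgroup_block cycC pP sCP (pgroup_orbit_coset x) sHC sMH).
  by rewrite iMH.
have orbE e : e \in E -> exists2 f, f \in 'C_P[v | 'P] & f w = w * e.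
  by move/ES; rewrite -orbw => /orbitP[f Pvf <-]; exists f.
(* The elements moving [w] within [w *: M] form a group [B] between the stabiliser of [v] and that
   of both [v] and [w]. The total index is the prime [q], so [B] is an end of the chain; the upper
   end would put [E] inside [M]. *)
have E_M1 e : e \in E -> e \in M -> e = 1.
  pose B := [set f in 'C_P[v | 'P] | w^-1 * f w \in M].
  have BE f : (f \in B) = (f \in 'C_P[v | 'P]) && (w^-1 * f w \in M) by rewrite inE.
  have gB : group_set B.
    apply/group_setP; split=> [|f k]; first by rewrite BE group1 perm1 mulVg group1.
    rewrite !BE => /andP[Pvf Mf] /andP[Pvk Mk]; rewrite groupM // permM.
    have [Pk _] := stabP _ Pvk; have := block k w _ Pk (subsetP sMH _ Mf).
    rewrite mulKVg groupMl ?groupV // => Mfk.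
    by rewrite -(mulKVg (k w) (k (f w))) mulgA groupM.
  pose W := 'C_('C_P[v | 'P])[w | 'P].
  have sWB : W \subset Group gB.
    apply/subsetP=> f /setIP[Pvf /astab1P]; rewrite /= /aperm BE Pvf => ->.
    by rewrite mulVg group1.
  have sBQ : Group gB \subset 'C_P[v | 'P].
    by apply/subsetP=> f; rewrite BE => /andP[].
  have: (#|'C_P[v | 'P] : Group gB| * #|Group gB : W|)%N = q.
    by rewrite Lagrange_index // -card_orbit orbw card_rcoset.
  have [iQB|niQB] := eqVneq #|'C_P[v | 'P] : Group gB| 1%N => iBW Ee Me.
    have sQB : 'C_P[v | 'P] \subset Group gB by rewrite -indexg_eq1 iQB.
    have: H \subset M.
      rewrite gen_subG; apply/subsetP=> e' /orbE[f /(subsetP sQB)].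
      by rewrite BE => /andP[_ Mf] fw; rewrite fw mulKg in Mf.
    by rewrite (negbTE (proper_subn (maxgroupp maxM))).
  have [f Pvf fw] := orbE e Ee.
  have sBW : Group gB \subset W.
    rewrite -indexg_eq1; have dvQB : #|'C_P[v | 'P] : Group gB| %| q.
      by rewrite -iBW dvdn_mulr.
    have /(prime_nt_dvdP q_pr niQB) iQB := dvQB.
    by rewrite -(eqn_pmul2l (prime_gt0 q_pr)) -{1}iQB iBW muln1.
  have: f \in W by rewrite (subsetP sBW) // BE Pvf fw mulKg.
  case/setIP=> _ /astab1P; rewrite /= /aperm fw => /(canRL (mulKg _)).
  by rewrite mulVg.
(* By transitivity on the out-neighbours, any element of [E] can take the role of 1, so distinct
   elements of [E] are distinct modulo [M]. *)
have E_M e e' : e \in E -> e' \in E -> e^-1 * e' \in M -> e = e'.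
  move=> Ee Ee' Mee'; have [f Pvf fw] := orbE e Ee.
  have Pvf' := groupVr Pvf; have [Pf' _] := stabP _ Pvf'.
  have := block f^-1 (w * e) _ Pf' (subsetP sMH _ Mee').
  rewrite -mulgA mulKVg -{1}fw permK groupMl ?groupV // => Mfe'.
  have Ef : w^-1 * f^-1 (w * e') \in E by apply: SvE; rewrite mulKVg stabS ?ES.
  have /eqP := E_M1 _ Ef Mfe'; rewrite -eq_invg_mul invgK => /eqP fe'.
  by apply: (mulgI w); rewrite -fw {1}fe' permKV.
have [Pg gv] := stabP _ Pvg.
(* [g1] and [g2] are [g] read in the coordinates of [v *: H] and [w *: H]. *)
have [g1 g1E] : exists g1, forall h, g (v * h) = v * g1 h.
  by exists (fun h => v^-1 * g (v * h)) => h; rewrite mulKVg.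
have [g2 g2E] : exists g2, forall h, g (w * h) = w * g2 h.
  by exists (fun h => w^-1 * g (w * h)) => h; rewrite mulKVg.
have g1M h : h \in H -> h^-1 * g1 h \in M.
  by move=> Hh; have := block g v h Pg Hh; rewrite gv g1E mulKg.
have g1H h : h \in H -> g1 h \in H.
  by move=> Hh; rewrite -(groupMl _ (groupVr Hh)) (subsetP sMH) ?g1M.
have E_g2 e : e \in E -> g2 e \in E.
  by move=> Ee; apply: SvE; rewrite -g2E stabS ?ES.
pose mu := g2 1.
have Emu : mu \in E by apply: E_g2.
have Hmu : mu \in H by apply: (subsetP sEH).
have nMmu : mu \notin M.
  apply: contra gw => Mmu; have mu1: 1 = mu by apply: E_M => //; rewrite invg1 mul1g.
  by rewrite -[w]mulg1 g2E -/mu -mu1.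
(* The pair [v * u], [w * (u * e)] is an arc, and its image puts [g2 (u * e) * (g1 u)^-1] in [E].
   The blocks make it congruent to [g2 e] modulo [M], hence equal to it. *)
have g2_mul u e : u \in H -> e \in E -> g2 (u * e) = g1 u * g2 e.
  move=> Hu Ee.
  have He := subsetP sEH _ Ee.
  have Hg2 h : h \in H -> g2 h \in H.
    move=> Hh; have := block g w h Pg Hh.
    rewrite -{1}[w]mulg1 !g2E invMg -mulgA mulKg -/mu => /(subsetP sMH).
    by rewrite groupMl ?groupV // groupMl ?groupV.
  have Ee' : g2 (u * e) * (g1 u)^-1 \in E.
    apply: SvE; rewrite mem_rcoset.
    have Sarc : cayley_arc S (v * u) (w * (u * e)).
      rewrite /cayley_arc (cCC u (CH _ Hu) e (CH _ He)) invMg -!mulgA mulKVg.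
      by have := ES _ Ee; rewrite mem_rcoset -mulgA.
    have := arcP g _ _ Pg Sarc; rewrite /cayley_arc g1E g2E invMg.
    by rewrite !mulgA.
  have: g2 e = g2 (u * e) * (g1 u)^-1.
    apply: E_M => //; first exact: E_g2.
    have := block g (w * e) u Pg Hu.
    rewrite -mulgA -(cCC u (CH _ Hu) e (CH _ He)) !g2E invMg -!mulgA mulKg => M1.
    have M2 := g1M u Hu.
    have ->: (g2 e)^-1 * (g2 (u * e) * (g1 u)^-1)
             = (u^-1 * ((g2 e)^-1 * g2 (u * e))) * (u^-1 * g1 u)^-1.
      have Cu := CH _ Hu; have Cx : (g2 e)^-1 * g2 (u * e) \in C.
        by rewrite CH // groupM ?groupV ?Hg2 ?groupM.
      rewrite invMg invgK (cCC u^-1 (groupVr Cu) _ Cx) -!mulgA; congr (_ * (_ * _)).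
      by rewrite (cCC _ (groupVr (CH _ (g1H _ Hu))) u Cu) mulKg.
    by rewrite groupM ?groupV.
  by move->; rewrite (cCC _ (CH _ (g1H _ Hu))) ?mulgKV // CH // groupM ?groupV ?Hg2 ?groupM ?g1H.
have g2mu u : u \in H -> g2 u = g1 u * mu.
  by move=> Hu; rewrite -{1}[u]mulg1 g2_mul.
have g1_mulE u e : u \in H -> e \in E -> g1 (u * e) = g1 u * g1 e.
  move=> Hu Ee; have He := subsetP sEH _ Ee.
  by apply: (mulIg mu); rewrite -g2mu ?groupM // g2_mul // g2mu // mulgA.
have g1_1 : g1 1 = 1 by apply: (mulgI v); rewrite -g1E !mulg1.
have g1_mul u y : u \in H -> y \in H -> g1 (u * y) = g1 u * g1 y.
  move=> Hu Hy.
  have: H \subset [set y in H | [forall u in H, g1 (u * y) == g1 u * g1 y]].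
    apply: gen_subset_lmul => [|e x Ee].
      by rewrite inE group1; apply/forall_inP=> z _; rewrite mulg1 g1_1 mulg1.
    rewrite !inE => /andP[Hx /forall_inP g1x]; have He := subsetP sEH _ Ee.
    rewrite groupM //; apply/forall_inP=> z Hz.
    by rewrite (eqP (g1x e He)) mulgA (eqP (g1x _ (groupM Hz He))) g1_mulE // mulgA.
  by move/subsetP/(_ y Hy); rewrite inE Hy => /forall_inP/(_ u Hu)/eqP.
have oHM : #|H| = (#|M| * q)%N by rewrite -(Lagrange sMH) iMH.
have cycH : cyclic H := cyclicS sHC cycC.
(* [H] has only one subgroup of index [q], and [mu] lies outside it. *)
have defH : <[mu]> = H.
  have smuH : <[mu]>%G \subset H by rewrite cycle_subG.
  have [// | [M' maxM']] := maximal_exists smuH; rewrite cycle_subG => M'mu.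
  have sM'H := proper_sub (maxgroupp maxM').
  case/negP: nMmu; rewrite (_ : M :=: M') //; apply/eqP.
  rewrite (eq_subG_cyclic cycH) // -(eqn_pmul2r (prime_gt0 q_pr)) -oHM.
  by rewrite -(Lagrange sM'H) (p_maximal_index pH maxM').
have omu : #[mu] = (#|M| * q)%N by rewrite orderE defH.
have M_mu i : (mu ^+ i \in M) = (q %| i).
  apply/idP/idP=> [Mi|/dvdnP[j ->]].
    have: (mu ^+ i) ^+ #|M| == 1.
      by rewrite -order_dvdn order_dvdG.
    by rewrite -expgM -order_dvdn omu mulnC dvdn_pmul2r.
  suff <- : <[mu ^+ q]> = M by rewrite mulnC expgM mem_cycle.
  apply/eqP; rewrite (eq_subG_cyclic cycH) ?cycle_subG ?groupX //.
  by rewrite -orderE orderXdiv ?omu ?dvdn_mull // mulnK ?prime_gt0.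
(* [g1] is the identity modulo [M], and [M] consists of the powers of [mu] with exponent divisible
   by [q]. *)
have [k g1mu] : exists k, g1 mu = mu ^+ (1 + q * k).
  have := g1M mu Hmu; have: mu^-1 * g1 mu \in <[mu]>.
    by rewrite defH groupM ?groupV ?g1H.
  case/cycleP=> i def_i; rewrite def_i M_mu => /dvdnP[k def_k].
  by exists k; rewrite expgD expg1 mulnC -def_k -def_i mulKVg.
have g1X i : g1 (mu ^+ i) = mu ^+ ((1 + q * k) * i).
  elim: i => [|i IHi]; first by rewrite muln0 !expg0.
  by rewrite expgSr g1_mul ?groupX // IHi g1mu -expgD mulnS addnC.
(* [F] is the action of [g2] on exponents of [mu]. Since [E] contains 1 and is stable under [g2],
   all iterates stay in [E]; the q-th one falls in [M], so it must be 1. *)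
pose F s := ((1 + q * k) * s + 1)%N.
have iterE j : mu ^+ iter j F 0%N \in E.
  elim: j => [|j IHj]; first exact: E1.
  by rewrite iterS /F expgD expg1 -g1X -g2mu ?groupX ?E_g2.
have iter_q : mu ^+ iter q F 0%N = 1.
  apply: E_M1 => //; rewrite M_mu; have [t ->] := affine_iter_mod q k q.
  by rewrite -!mulnA !dvdn_add // dvdn_mulr.
have oH : #|H| = q.
  have dvd_omu : #[mu] %| iter q F 0%N by rewrite order_dvdn iter_q.
  have ntH' : H :!=: 1 by rewrite eq_sym; apply: proper_neq ntH.
  have [_ _ [[|e] oHe]] := pgroup_pdiv pH ntH'; first by rewrite oHe expn1.
  case/negP: (affine_iter_ndvd k q_pr q_odd); apply: dvdn_trans dvd_omu.
  by rewrite orderE defH oHe dvdn_exp2l.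
have defE : E = H by apply/eqP; rewrite eqEcard sEH oH oE leqnn.
exists H, (w * v^-1); split=> //; apply/setP=> y.
rewrite mem_lcoset invMg invgK -(memJ_norm _ (dih_norm dihC v sHC)) conjgE.
rewrite -!mulgA mulKg -defE.
apply/idP/idP=> [Sy|/ES]; [apply: SvE|]; by rewrite mulKVg mem_rcoset mulgK.
Qed.

End LargeSylow.


(** * Digraph isomorphisms and generated subgroups *)

Lemma AutT_mul (gT : finGroupType) (a : {perm gT}) :
  a \in Aut [set: gT] -> {morph a : x y / x * y}.
Proof. by rewrite inE => /andP[_ /morphicP aM] x y; apply: aM; rewrite inE. Qed.

Lemma cayley_iso1 (gT : finGroupType) (S T : {set gT}) : cayley_iso S T ->
  exists2 f : {perm gT}, f 1 = 1
    & forall x y, cayley_arc S x y = cayley_arc T (f x) (f y).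
Proof.
case=> f fST; exists (f * rtrans (f 1)^-1); first by rewrite permM rtransE mulgV.
by move=> x y; rewrite !permM !rtransE rtrans_arc.
Qed.

Lemma cayley_iso_image (gT : finGroupType) (S T : {set gT}) (f : {perm gT}) :
    (forall x y, cayley_arc S x y = cayley_arc T (f x) (f y)) ->
  forall x, f @: (S :* x) = T :* f x.
Proof.
move=> fST x; apply/setP=> y; rewrite -[y](permKV f) mem_imset; last exact: perm_inj.
by rewrite !mem_rcoset; apply: fST.
Qed.

Lemma cayley_iso_gen_sub (gT : finGroupType) (S T : {set gT}) (f : {perm gT}) :
    f 1 = 1 -> (forall x y, cayley_arc S x y = cayley_arc T (f x) (f y)) ->
  f @: <<S>> \subset <<T>>.
Proof.
move=> f1 fST; rewrite sub_imset_pre; apply: gen_subset_lmul => [|s x Ss].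
  by rewrite inE f1 group1.
rewrite !inE => Tfx; rewrite -(mulgKV (f x) (f (s * x))) groupM // mem_gen //.
by rewrite -[_ \in T]fST /cayley_arc mulgK.
Qed.

Lemma cayley_iso_gen (gT : finGroupType) (S T : {set gT}) (f : {perm gT}) :
    f 1 = 1 -> (forall x y, cayley_arc S x y = cayley_arc T (f x) (f y)) ->
  f @: <<S>> = <<T>>.
Proof.
move=> f1 fST; apply/eqP; rewrite eqEcard cayley_iso_gen_sub //.
rewrite card_imset; last exact: perm_inj.
rewrite -(card_imset _ (@perm_inj _ f^-1)) subset_leq_card //.
apply: cayley_iso_gen_sub => [|x y]; first by rewrite -{1}f1 permK.
by rewrite fST !permKV.
Qed.

(** * Constructing and extending automorphisms *)

Section DihedralAut.

Variables (gT : finGroupType) (A : {group gT}).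
Hypothesis dihA : dihedral_over A.

(** The hypothesis on [b0] and [b1] only asks that they lie outside [A] when [A] is proper; one
    construction thus serves the cyclic and the dihedral case. *)
Lemma dih_power_aut r b0 b1 : coprime #|A| r ->
    (forall x, x \notin A -> b0 \notin A /\ b1 \notin A) ->
  exists2 a : {perm gT}, a \in Aut [set: gT]
    & (forall c, c \in A -> a c = c ^+ r) /\ (b0 \notin A -> a b0 = b1).
Proof.
move=> co_r outA; pose F x := if x \in A then x ^+ r else b1 * (b0 * x) ^+ r.
have outM x y : x \notin A -> y \notin A -> x * y \in A by case: dihA => _ _; apply.
have sq1 x : x \notin A -> x * x = 1 by case: dihA => _ + _; apply.
have Fout x : x \notin A -> F x \notin A.
  move=> nAx; have [nAb0 nAb1] := outA x nAx.
  by rewrite /F (negbTE nAx) groupMr ?groupX ?outM.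
have Finj : injective F.
  have XI : {in A &, injective (fun x => x ^+ r)} := can_in_inj (expgK co_r).
  move=> x y; have [Ax|nAx] := boolP (x \in A); have [Ay|nAy] := boolP (y \in A).
  - by rewrite /F Ax Ay; apply: XI.
  - by move=> eqF; have := Fout y nAy; rewrite -eqF /F Ax groupX.
  - by move=> eqF; have := Fout x nAx; rewrite eqF /F Ay groupX.
  have [nAb0 nAb1] := outA x nAx; rewrite /F (negbTE nAx) (negbTE nAy).
  by move/mulgI/XI => eqxy; apply: (mulgI b0); apply: eqxy; apply: outM.
exists (perm Finj).
  apply: (dih_normalising_aut dihA) => [|c Ac|x c Ac]; rewrite !permE /F.
  - by rewrite group1 expg1n.
  - by rewrite Ac groupX.
  rewrite groupMr // Ac; have [Ax|nAx] := boolP (x \in A).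
    by rewrite expgMn //; apply: (dih_abelian dihA).
  have [nAb0 nAb1] := outA x nAx.
  by rewrite mulgA expgMn ?mulgA //; apply: (dih_abelian dihA) => //; apply: outM.
split=> [c Ac|nAb0]; rewrite permE /F ?Ac // (negbTE nAb0).
by rewrite sq1 // expg1n mulg1.
Qed.

Lemma dih_power_aut1 r : coprime #|A| r ->
  exists2 a : {perm gT}, a \in Aut [set: gT] & forall c, c \in A -> a c = c ^+ r.
Proof.
move=> co_r; have [/existsP[b nAb]|] := boolP [exists b, b \notin A].
  by have [|a Aa [aX _]] := @dih_power_aut r b b co_r; last by exists a.
rewrite negb_exists => /forallP AT.
have [|a Aa [aX _]] := @dih_power_aut r 1 1 co_r; last by exists a.
by move=> x; rewrite (negbTE (AT x)).
Qed.

Lemma dih_sq x : x \notin A -> x * x = 1.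
Proof. by case: dihA => _ + _; apply. Qed.

Lemma dih_outer_rep b x : b \notin A -> x = b * (b * x).
Proof. by move=> nAb; rewrite mulgA dih_sq // mul1g. Qed.

Lemma dih_outer_mul x y : x \notin A -> y \notin A -> x * y \in A.
Proof. by case: dihA => _ _; apply. Qed.

Variable q : nat.
Hypotheses (q_pr : prime q) (q_odd : odd q) (pA : q.-group A).

(** On the cyclic group [K :&: A] the map [phi] is a power map, which extends to [A] once its
    exponent is prime to [q]; an element of [K] outside [A], if any, fixes the rest. *)
Lemma dih_extend_aut (K : {group gT}) (phi : gT -> gT) :
    {in K &, {morph phi : x y / x * y}} -> {in K &, injective phi} ->
    {in K, forall x, phi x \in K} ->
  exists2 a : {perm gT}, a \in Aut [set: gT] & {in K, phi =1 a}.
Proof.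
move=> phiM phiI phiK.
have phi1 : phi 1 = 1 by apply: (mulgI (phi 1)); rewrite -phiM ?group1 // !mulg1.
have phiX x i : x \in K -> phi (x ^+ i) = phi x ^+ i.
  move=> Kx; elim: i => [|i IHi]; first by rewrite !expg0.
  by rewrite !expgS phiM ?groupX // IHi.
have cycA : cyclic A by case: dihA.
have [c defC] := cyclicP (cyclicS (subsetIr K A) cycA).
have Cc : c \in K :&: A by rewrite defC cycle_id.
have [Kc Ac] := setIP Cc.
have oddA : odd #|A| by have [e ->] := p_natP pA; rewrite oddX q_odd orbT.
have odd_mem x y : x \in A -> y ^+ #[x] = 1 -> y \in A.
  move=> Ax yx1; apply: (dih_odd_order_mem dihA); apply: dvdn_odd oddA.
  by apply: dvdn_trans (order_dvdG Ax); rewrite order_dvdn yx1.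
have [i def_i] : exists i, phi c = c ^+ i.
  apply/cycleP; rewrite -defC inE phiK // (odd_mem c) //.
  by rewrite -phiX // expg_order.
(* If [c] is trivial the exponent 1 serves. Otherwise [q] dividing [i] would make [phi] kill the
   element of order [q] in [<[c]>]. *)
have [r co_r cr] : exists2 r, coprime #|A| r & c ^+ r = c ^+ i.
  have [c1|ntc] := eqVneq c 1; first by exists 1%N; rewrite ?coprimen1 // c1 !expg1n.
  exists i => //; have [e oA] := p_natP pA; rewrite oA coprimeXl // prime_coprime //.
  apply/negP=> qi.
  have pc : q.-group <[c]> by rewrite -defC; apply: pgroupS (subsetIr _ _) pA.
  have [|_ _ [j oc]] := pgroup_pdiv pc; first by rewrite cycle_eq1.
  have: c ^+ (q ^ j) = 1.
    apply: phiI; rewrite ?groupX ?group1 // phi1 phiX // def_i -expgM.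
    have /dvdnP[l ->] := qi; apply/eqP; rewrite -order_dvdn orderE oc expnS.
    by rewrite -mulnA dvdn_mull.
  move/eqP; rewrite -order_dvdn orderE oc => /(dvdn_leq _).
  by rewrite expn_gt0 prime_gt0 // leq_exp2l ?prime_gt1 // ltnn => /(_ isT).
have phiA x : x \in K -> x \in A -> phi x = x ^+ r.
  move=> Kx Ax; have /cycleP[m ->] : x \in <[c]> by rewrite -defC inE Kx.
  by rewrite phiX // def_i -cr -!expgM mulnC.
have [sKA|/subsetPn[b Kb nAb]] := boolP (K \subset A).
  have [a Aa aX] := dih_power_aut1 co_r; exists a => // x Kx.
  by rewrite aX ?phiA ?(subsetP sKA).
(* The image of [b] squares to 1, and in [A], of odd order, only 1 does so. *)
have nAphib : phi b \notin A.
  apply/negP=> Aphi; have: phi b * phi b = 1.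
    by rewrite -phiM // dih_sq // phi1.
  move=> phib2; suff: phi b = 1.
    by rewrite -phi1 => /phiI b1; rewrite b1 ?group1 in nAb.
  apply/eqP; rewrite -order_eq1 -dvdn1.
  have: #[phi b] %| gcdn 2 #|A| by rewrite dvdn_gcd order_dvdn expgS expg1 phib2 eqxx order_dvdG.
  by have /eqP-> : coprime 2 #|A| by rewrite coprime2n.
have [//|a Aa [aX ab]] := @dih_power_aut r b (phi b) co_r; exists a => // x Kx.
have [Ax|nAx] := boolP (x \in A); first by rewrite aX ?phiA.
have Abx : b * x \in A by apply: dih_outer_mul.
rewrite (dih_outer_rep x nAb) phiM ?groupM // AutT_mul // ab // aX //.
by rewrite [phi (b * x)]phiA // groupM.
Qed.

End DihedralAut.


(** * Connection sets that are cosets, and the connected case *)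

(* Vertices with the same out-neighbours: the right stabiliser of a connection *)
(* set is visible in the digraph, so being a coset of Z is an isomorphism      *)
(* invariant.                                                                  *)
Lemma cayley_iso_coset (gT : finGroupType) (C Z : {group gT}) (q : nat)
    (S T : {set gT}) (s : gT) :
    dihedral_over C -> prime q -> odd q -> Z \subset C -> #|Z| = q ->
    S = s *: Z -> cayley_iso S T ->
  exists t, T = t *: Z.
Proof.
move=> dihC q_pr q_odd sZC oZ defS /cayley_iso1[f f1 fST].
have fS := cayley_iso_image fST.
have defT : T = f @: S by have := fS 1; rewrite f1 !rcoset1.
have oT : #|T| = q by rewrite defT card_imset ?defS ?card_lcoset //; apply: perm_inj.
pose W := [set t | T :* t == T].
have gW : group_set W.
  apply/group_setP; split=> [|x y]; first by rewrite inE rcoset1.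
  by rewrite !inE => /eqP Tx /eqP Ty; rewrite rcosetM Tx Ty.
(* Right translation by [z] in [Z] preserves [S], and [f] carries [S :* z] to [T :* f z], so [f z]
   stabilises [T]. *)
have sfZ : f @: Z \subset W.
  apply/subsetP=> _ /imsetP[z Zz ->]; rewrite inE -fS.
  suff -> : S :* z = S by rewrite -defT.
  by apply/setP=> y; rewrite defS mem_rcoset !mem_lcoset mulgA groupMr ?groupV.
have leqW : q <= #|W|.
  by rewrite -oZ -(card_imset _ (@perm_inj _ f)) subset_leq_card.
have [t Tt] : exists t, t \in T by apply/card_gt0P; rewrite oT prime_gt0.
have stW : t *: W \subset T.
  by apply/subsetP=> _ /lcosetP[x /[!inE] /eqP <- ->]; rewrite mem_rcoset mulgK.
have oW : #|W| = q.
  by apply/eqP; rewrite eqn_leq leqW andbT -oT -(card_lcoset W t) subset_leq_card.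
have sWC : Group gW \subset C.
  apply/subsetP=> x Wx; apply: (dih_odd_order_mem dihC); apply: dvdn_odd q_odd.
  by rewrite -oW; apply: (order_dvdG (G := Group gW)).
have cycC : cyclic C by case: dihC.
have defZ : Group gW :=: Z by apply/eqP; rewrite (eq_subG_cyclic cycC) //= oW oZ.
exists t; apply/esym/eqP; rewrite eqEcard -defZ /= stW card_lcoset oW oT.
exact: leqnn.
Qed.

(** In a cyclic q-group the subgroup of order [q] lies in every nontrivial subgroup, in particular
    in [<[s]>]. *)
Lemma cyclic_coset_gen (gT : finGroupType) (Z : {group gT}) (q : nat) (s : gT) :
    cyclic [set: gT] -> q.-group [set: gT] -> prime q -> #|Z| = q ->
    1 \notin s *: Z -> <<s *: Z>> = [set: gT] ->
  <[s]> = [set: gT].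
Proof.
move=> cycG pG q_pr oZ nS1 genS; apply/eqP; rewrite eqEsubset subsetT -genS gen_subG.
have pc : q.-group <[s]> by apply: pgroupS (subsetT _) pG.
have [|_ qs _] := pgroup_pdiv pc.
  by rewrite cycle_eq1; apply: contraNneq nS1 => ->; rewrite mem_lcoset mulg1 groupV group1.
have sZs : Z \subset <[s]> by rewrite -(cardSg_cyclic cycG) ?subsetT // oZ.
apply/subsetP=> _ /lcosetP[z Zz ->].
by rewrite groupM ?cycle_id // (subsetP sZs).
Qed.

(** If [s] lies in [C], then [C] is everything, both [s] and [t] generate it, and a power map takes
    [s] to [t]. Otherwise an automorphism trivial on [C] takes one outer element to the other. *)
Lemma coset_equiv (gT : finGroupType) (C Z : {group gT}) (q : nat) (s t : gT) :
    dihedral_over C -> q.-group C -> prime q -> Z \subset C -> #|Z| = q ->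
    <<s *: Z>> = [set: gT] -> <<t *: Z>> = [set: gT] ->
    1 \notin s *: Z -> 1 \notin t *: Z ->
  exists2 a : {perm gT}, a \in Aut [set: gT] & a @: (s *: Z) = t *: Z.
Proof.
move=> dihC pC q_pr sZC oZ genS genT nS1 nT1.
have memC u : <<u *: Z>> = [set: gT] -> u \in C -> [set: gT] = C.
  move=> genu Cu; apply/eqP; rewrite eqEsubset subsetT -genu gen_subG.
  rewrite andbT; apply/subsetP=> _ /lcosetP[z Zz ->].
  by rewrite groupM // (subsetP sZC).
have cycC : cyclic C by case: dihC.
suff [a [r [Aa aX ast]]] : exists (a : {perm gT}) r,
    [/\ a \in Aut [set: gT], forall c, c \in C -> a c = c ^+ r & a s = t].
  exists a => //; apply/eqP; rewrite eqEcard card_imset ?card_lcoset; last exact: perm_inj.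
  rewrite leqnn andbT; apply/subsetP=> _ /imsetP[_ /lcosetP[z Zz ->] ->].
  by rewrite AutT_mul // ast aX ?(subsetP sZC) // mem_lcoset mulKg groupX.
have [Cs|nCs] := boolP (s \in C).
  have defC := memC s genS Cs; rewrite defC in genS genT.
  have [cycG pG] : cyclic [set: gT] /\ q.-group [set: gT] by rewrite defC.
  rewrite -defC in genS genT.
  have gs := cyclic_coset_gen cycG pG q_pr oZ nS1 genS.
  have gt := cyclic_coset_gen cycG pG q_pr oZ nT1 genT.
  have /cycleP[r tr] : t \in <[s]> by rewrite gs inE.
  have co_r : coprime #|C| r.
    by rewrite -defC -gs -orderE -generator_coprime /generator -tr gs gt.
  have [a Aa aX] := dih_power_aut1 dihC co_r.
  by exists a, r; split=> //; rewrite aX.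
have nCt : t \notin C.
  by apply: contra nCs => /(memC t genT) <-; rewrite inE.
have [//|a Aa [aX ast]] := @dih_power_aut _ _ dihC 1 s t (coprimen1 _).
by exists a, 1%N; split=> //; apply: ast.
Qed.

Theorem dih_connected_CI (gT : finGroupType) (C : {group gT}) (q : nat)
    (S T : {set gT}) :
    dihedral_over C -> q.-group C -> prime q -> odd q -> #|S| <= q ->
    <<S>> = [set: gT] -> <<T>> = [set: gT] -> 1 \notin S -> 1 \notin T ->
    cayley_iso S T ->
  exists2 a : {perm gT}, a \in Aut [set: gT] & a @: S = T.
Proof.
move=> dihC pC q_pr q_odd leSq genS genT nS1 nT1 isoST.
have pR : q.-group (rtrans @* C) by rewrite morphim_pgroup.
have [P sylP sRP] := Sylow_superset (rtrans_cayley_aut S C) pR.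
have [sPA pP _] := and3P sylP.
have [eqRP|neqRP] := eqVneq (rtrans @* C) P.
  by apply: (Sylow_cayley_aut_equiv (q := q) dihC) => //; rewrite eqRP.
have ltCP : #|C| < #|P|.
  by rewrite -card_rtrans proper_card // properEneq neqRP.
have [Z [s [sZC oZ defS]]] :=
  large_Sylow_coset q_pr q_odd dihC pC genS leSq sPA pP sRP ltCP.
have [t defT] := cayley_iso_coset dihC q_pr q_odd sZC oZ defS isoST.
rewrite defS defT in genS genT nS1 nT1 *.
exact: coset_equiv dihC pC q_pr sZC oZ genS genT nS1 nT1.
Qed.


(** * Reduction to connection sets that generate *)

Section Disconnected.

Variables (gT : finGroupType) (A : {group gT}) (q : nat).
Hypotheses (dihA : dihedral_over A) (pA : q.-group A).
Hypotheses (q_pr : prime q) (q_odd : odd q).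

Lemma dih_card_outer (K : {group gT}) b : b \in K -> b \notin A ->
  #|K| = (2 * #|K :&: A|)%N.
Proof.
move=> Kb nAb; rewrite -(cardsID A K) mul2n -addnn; congr (_ + _)%N.
rewrite -(card_lcoset (K :&: A) b); congr #|pred_of_set _|; apply/setP=> x.
rewrite mem_lcoset (dih_inv dihA nAb) inE [RHS]inE groupMl // andbC; congr (_ && _).
exact: dih_outer_mem.
Qed.

Lemma dih_odd_sub (K : {group gT}) : odd #|K| -> K \subset A.
Proof.
move=> oddK; apply/subsetP=> x Kx; apply: (dih_odd_order_mem dihA).
exact: dvdn_odd (order_dvdG Kx) oddK.
Qed.

Lemma dih_sub_odd (K : {group gT}) : K \subset A -> odd #|K|.
Proof.
move=> sKA; have [e ->] := p_natP (pgroupS sKA pA : q.-nat #|K|).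
by rewrite oddX q_odd orbT.
Qed.

(** Parity of the order tells whether a subgroup lies in [A]. If not, [K] and [L] meet [A] in the
    same subgroup, and an automorphism trivial on [A] matches their outer elements. *)
Lemma dih_eq_card_equiv (K L : {group gT}) : #|K| = #|L| ->
  exists2 a : {perm gT}, a \in Aut [set: gT] & a @: L = K.
Proof.
move=> oKL; have cycA : cyclic A by case: dihA.
have [sKA|nsKA] := boolP (K \subset A).
  have sLA : L \subset A by rewrite dih_odd_sub // -oKL dih_sub_odd.
  have -> : L :=: K by apply/eqP; rewrite (eq_subG_cyclic cycA) // oKL.
  exists 1; first exact: group1.
  by rewrite -[RHS]imset_id; apply: eq_imset => x; rewrite perm1.
have nsLA : ~~ (L \subset A).
  by apply: contra nsKA => /dih_sub_odd; rewrite -oKL; apply: dih_odd_sub.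
have [[b Kb nAb] [d Ld nAd]] := (subsetPn nsKA, subsetPn nsLA).
have eqKL : K :&: A = L :&: A.
  apply/eqP; rewrite (eq_subG_cyclic cycA) ?subsetIr // -(eqn_pmul2l (isT : 0 < 2)).
  by rewrite -(dih_card_outer Kb) // -(dih_card_outer Ld) // oKL.
have [//|a Aa [aX adb]] := @dih_power_aut _ _ dihA 1 d b (coprimen1 _).
exists a => //; apply/eqP; rewrite eqEcard card_imset ?oKL ?leqnn ?andbT; last exact: perm_inj.
apply/subsetP=> _ /imsetP[x Lx ->]; have [Ax|nAx] := boolP (x \in A).
  by have: x \in K :&: A; [rewrite eqKL inE Lx | case/setIP; rewrite aX].
have: d * x \in K :&: A by rewrite eqKL inE groupM ?dih_outer_mul.
case/setIP=> Kdx Adx; rewrite (dih_outer_rep dihA x nAd) AutT_mul // adb // aX //.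
by rewrite expg1 groupM.
Qed.

(** Allows the connected case to be applied with [K] as the ambient group. *)
Lemma dihedral_over_subg (K : {group gT}) :
  dihedral_over (sgval @*^-1 A : {group [subg K]})%G
  /\ q.-group (sgval @*^-1 A : {group [subg K]})%G.
Proof.
have cycA : cyclic A by case: dihA.
have inj : 'injm (@sgval _ K) := injm_sgval K.
have sub : sgval @* (sgval @*^-1 A : {set [subg K]}) \subset A.
  by apply/subsetP=> _ /morphimP[x _ /morphpreP[_ Ax] ->].
split; last by rewrite -(injm_pgroup inj) ?(pgroupS sub) ?subsetT.
have memE (x : [subg K]) : (x \in sgval @*^-1 A) = (sgval x \in A).
  by apply/morphpreP/idP=> [[]|Ax] //; rewrite inE.
split=> [|x|x y].
- by rewrite -(injm_cyclic inj) ?subsetT // (cyclicS sub).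
- by rewrite memE => nAx; apply: val_inj; rewrite /= (dih_sq dihA).
- by rewrite !memE /= => nAx nAy; apply: dih_outer_mul.
Qed.

(** An automorphism first brings [<<T0>>] onto [K], the group generated by [S]. The connected case
    inside [K] then gives an automorphism of [K], which extends to the whole group. *)
Theorem dih_small_CI (S : {set gT}) : 1 \notin S -> #|S| <= q -> CI_subset S.
Proof.
move=> nS1 leSq T0 nT01 isoST0.
have [a Aa genaT] : exists2 a : {perm gT}, a \in Aut [set: gT] & a @: <<T0>> = <<S>>.
  apply: dih_eq_card_equiv; have [f f1 fST] := cayley_iso1 isoST0.
  by rewrite /= -(cayley_iso_gen f1 fST) card_imset //; apply: perm_inj.
pose T := a @: T0.
have aM := AutT_mul Aa.
have a1 : a 1 = 1 by apply: (mulgI (a 1)); rewrite -aM !mulg1.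
have aV x : a x^-1 = (a x)^-1 by apply: (mulgI (a x)); rewrite -aM !mulgV.
have nT1 : 1 \notin T by rewrite -a1 mem_imset //; apply: perm_inj.
have isoST : cayley_iso S T.
  have [f fST] := isoST0; exists (f * a) => x y; rewrite fST !permM /cayley_arc.
  by rewrite -aV -aM mem_imset //; apply: perm_inj.
have [f f1 fST] := cayley_iso1 isoST.
set K := <<S>>%G.
have genT : <<T>> = K.
  have oT : #|<<T>>| = #|K|.
    by rewrite -(cayley_iso_gen f1 fST) card_imset //; apply: perm_inj.
  apply/eqP; rewrite eqEcard oT leqnn andbT gen_subG /= -genaT.
  exact/imsetS/subset_gen.
have fK x : x \in K -> f x \in K.
  by rewrite -{2}genT -(cayley_iso_gen f1 fST) => Kx; apply: imset_f.
have sSK : S \subset K := subset_gen S.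
have sTK : T \subset K by rewrite -genT subset_gen.
pose pre (X : {set gT}) := [set x : [subg K] | sgval x \in X].
have preE (X : {set gT}) : X \subset K -> sgval @: pre X = X.
  move=> sXK; apply/setP=> x; apply/imsetP/idP=> [[y /[!inE] Xy -> //]|Xx].
  by exists (subg K x); rewrite ?inE subgK // (subsetP sXK).
have genpre (X : {set gT}) : X \subset K -> <<X>> = K -> <<pre X>> = [set: [subg K]].
  move=> sXK genX; apply/eqP; rewrite eqEsubset subsetT /=; apply/subsetP=> x _.
  have: sgval x \in sgval @* <<pre X>>.
    rewrite morphim_gen ?subsetT // morphimEsub ?subsetT // preE // genX.
    exact: subgP.
  by case/morphimP=> y _ Xy /val_inj ->.
pose f1' (x : [subg K]) := subg K (f (sgval x)).
have f1'E x : sgval (f1' x) = f (sgval x) by rewrite subgK ?fK ?subgP.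
have f1'I : injective f1'.
  by move=> x y /(congr1 sgval); rewrite !f1'E => /perm_inj/val_inj.
have isoK : cayley_iso (pre S) (pre T).
  exists (perm f1'I) => x y; rewrite !permE /cayley_arc !inE /= !f1'E.
  exact: fST.
have [dihK pK] := dihedral_over_subg K.
have npre (X : {set gT}) : 1 \notin X -> 1 \notin pre X by rewrite inE.
have leK : #|pre S| <= q by rewrite -(card_imset _ val_inj) preE.
have [s As sST] := dih_connected_CI dihK pK q_pr q_odd leK
  (genpre S sSK erefl) (genpre T sTK genT) (npre S nS1) (npre T nT1) isoK.
pose phi x := sgval (s (subg K x)).
have sM := AutT_mul As.
have [c Ac cphi] : exists2 c : {perm gT}, c \in Aut [set: gT] & {in K, phi =1 c}.
  apply: (dih_extend_aut dihA q_pr q_odd pA) => [x y Kx Ky|x y Kx Ky|x Kx].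
  - by rewrite /phi -[sgval _ * _]/(sgval (_ * _)) -sM morphM.
  - by move/val_inj/perm_inj/(congr1 sgval); rewrite !subgK.
  exact: subgP.
exists (c * a^-1); first by rewrite groupM ?groupV.
have cS : c @: S = T.
  rewrite -(preE S sSK) -(preE T sTK) -sST -!imset_comp; apply: eq_imset => x /=.
  by rewrite -cphi ?subgP // /phi sgvalK.
rewrite (_ : T0 = a^-1 @: T); last first.
  by rewrite -imset_comp -[LHS]imset_id; apply: eq_imset => x /=; rewrite permK.
by rewrite -cS -imset_comp; apply: eq_imset => x; rewrite /= permM.
Qed.

End Disconnected.


(** * Building isomorphisms between Cayley digraphs *)

Lemma eq_card_injection (T : finType) (A B : {set T}) : #|A| = #|B| ->
  exists2 h : T -> T, {in A &, injective h} & {in A, forall x, h x \in B}.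
Proof.
move=> oAB; pose h x := nth x (enum B) (index x (enum A)).
have ltB x : x \in A -> index x (enum A) < size (enum B).
  by move=> Ax; rewrite -cardE -oAB cardE index_mem mem_enum.
exists h => [x y Ax Ay|x Ax]; last by rewrite -mem_enum mem_nth ?ltB.
rewrite /h (set_nth_default x) ?ltB // => /eqP.
rewrite nth_uniq ?enum_uniq ?ltB // => /eqP/(congr1 (nth x (enum A))).
by rewrite !nth_index ?mem_enum.
Qed.

(* phi is extended coset by coset, along a bijection between the right cosets *)
(* of K and those of L. *)
Lemma cayley_iso_coset_lift (gT : finGroupType) (K L : {group gT})
    (S T : {set gT}) (phi : gT -> gT) :
    #|K| = #|L| -> S \subset K -> T \subset L ->
    {in K &, injective phi} -> {in K, forall x, phi x \in L} ->
    {in K &, forall x y, cayley_arc S x y = cayley_arc T (phi x) (phi y)} ->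
  cayley_iso S T.
Proof.
move=> oKL sSK sTL phiI phiL phiST.
have [|h hI hL] := @eq_card_injection _ (rcosets K [set: gT]) (rcosets L [set: gT]).
  apply/eqP; rewrite -(eqn_pmul2l (cardG_gt0 K)) -/(#|[set: gT] : K|) -/(#|[set: gT] : L|).
  by rewrite {2}oKL !Lagrange ?subsetT.
pose rho x := repr (K :* x); pose k x := x * (rho x)^-1.
have Kk x : k x \in K.
  rewrite /k -mem_rcoset /rho; case: repr_rcosetP => c Kc.
  by rewrite rcosetM rcoset_id // rcoset_refl.
have kx x : k x * rho x = x by rewrite mulgKV.
clearbody k.
have Kcos x : K :* x \in rcosets K [set: gT] by apply/rcosetsP; exists x; rewrite ?inE.
pose r x := repr (h (K :* x)).
have hr x : h (K :* x) = L :* r x.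
  have /rcosetsP[y _ defy] := hL _ (Kcos x).
  by rewrite /r defy; case: repr_rcosetP => c Lc; rewrite rcosetM (rcoset_id Lc).
pose f x := phi (k x) * r x.
(* [f] keeps distinct cosets of [K] in distinct cosets of [L], so neither digraph has arcs between
   different pieces. *)
have f_r x y : f y * (f x)^-1 \in L -> K :* x = K :* y.
  move=> Lfxy; apply: hI => //; rewrite !hr; apply: rcoset_eqP.
  rewrite mem_rcoset; move: Lfxy; rewrite /f invMg -!mulgA groupMl ?phiL // mulgA.
  by rewrite groupMr ?groupV ?phiL // -groupV invMg invgK.
have eqK x y : K :* x = K :* y -> (rho x = rho y) * (r x = r y).
  by rewrite /rho /r => ->.
have fI : injective f.
  move=> x y eqf; have [|rhoxy rxy] := eqK x y.
    by apply: f_r; rewrite eqf mulgV group1.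
  move: eqf; rewrite /f rxy => /mulIg/phiI eqk.
  by rewrite -(kx x) -(kx y) eqk // rhoxy.
exists (perm fI) => x y; rewrite !permE /cayley_arc.
have [eqxy|neqxy] := eqVneq (K :* x) (K :* y).
  have [rhoxy rxy] := eqK x y eqxy.
  have -> : y * x^-1 = k y * (k x)^-1.
    by rewrite -{1}(kx y) -{1}(kx x) rhoxy invMg mulgA mulgK.
  by rewrite /f rxy invMg mulgA mulgK; apply: phiST.
transitivity false; [|symmetry]; apply: contraNF neqxy.
  by move/(subsetP sSK) => Kyx; rewrite eq_sym; apply/eqP/rcoset_eqP; rewrite mem_rcoset.
by move/(subsetP sTL)/f_r/eqP.
Qed.

(* The hypothesis on phi says that it carries the arcs of a symmetric Cayley *)
(* digraph on K to those of its image, although phi need not be a morphism.   *)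
Lemma cayley_iso_twist (gT : finGroupType) (K : {group gT}) (S : {set gT})
    (phi : gT -> gT) :
    {in K &, injective phi} ->
    {in K &, forall x y, phi y * (phi x)^-1 = phi (y * x^-1)
                      \/ phi y * (phi x)^-1 = phi (x * y^-1)} ->
    S \subset K -> {in S, forall x, x^-1 \in S} ->
  cayley_iso S (phi @: S).
Proof.
move=> phiI phiD sSK SV.
have phi1 : phi 1 = 1.
  by have := phiD 1 1 (group1 K) (group1 K); rewrite invg1 mulg1 mulgV => -[].
(* Every quotient of two images is again an image, so the image of [K] is a group. *)
have gL : group_set (phi @: K).
  have LV x : x \in phi @: K -> x^-1 \in phi @: K.
    case/imsetP=> y Ky ->; have := phiD y 1 Ky (group1 K).
    by rewrite phi1 mul1g => -[] ->; apply: imset_f; rewrite groupM ?groupV.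
  apply/group_setP; split=> [|x y Lx /LV]; first by rewrite -phi1 imset_f.
  rewrite -{2}[y]invgK => /imsetP[v Kv ->]; case/imsetP: Lx => u Ku ->.
  by case: (phiD v u Kv Ku) => ->; apply: imset_f; rewrite groupM ?groupV.
have memS x : x \in K -> (phi x \in phi @: S) = (x \in S).
  move=> Kx; apply/imsetP/idP=> [[y Sy /phiI->]|Sx] //; last by exists x.
  exact: (subsetP sSK).
apply: (@cayley_iso_coset_lift _ K (Group gL) _ _ phi) => //=.
- by rewrite card_in_imset.
- exact: imsetS.
- by move=> x Kx; apply: imset_f.
move=> x y Kx Ky; rewrite /cayley_arc.
case: (phiD x y Kx Ky) => ->; rewrite memS ?groupM ?groupV //.
by apply/idP/idP=> /SV; rewrite invMg invgK.
Qed.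

(** * Necessity: the order of the rotation must be odd *)

Section DihedralNonCI.

Variables (gT : finGroupType) (a b : gT).
Let A := <[a]>.
Hypotheses (dihA : dihedral_over <[a]>) (nAb : b \notin A) (n_gt2 : 2 < #[a]).

(** [a] has order above 2, while every element outside [A] squares to 1. *)
Lemma dih_Aut_cyclic (s : {perm gT}) x : s \in Aut [set: gT] -> x \in A -> s x \in A.
Proof.
move=> As Ax; have sM := AutT_mul As.
have s1 : s 1 = 1 by apply: (mulgI (s 1)); rewrite -sM !mulg1.
have sX i : s (a ^+ i) = s a ^+ i.
  by elim: i => [|i IHi]; rewrite ?expg0 // !expgS sM IHi.
have Asa : s a \in A.
  apply: contraLR n_gt2 => nAsa; rewrite -leqNgt dvdn_leq // order_dvdn.
  by apply/eqP/(@perm_inj _ s); rewrite s1 sX expgS expg1 (dih_sq dihA).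
by have /cycleP[i ->] := Ax; rewrite sX groupX.
Qed.

Lemma not_CI_of_outer (S T : {set gT}) x :
    S \subset A -> x \in T -> x \notin A -> 1 \notin T -> cayley_iso S T ->
  ~ CI_subset S.
Proof.
move=> sSA Tx nAx nT1 isoST CIS; have [s As sST] := CIS T nT1 isoST.
case/negP: nAx; move: Tx; rewrite -sST => /imsetP[y Sy ->].
by apply: dih_Aut_cyclic => //; apply: (subsetP sSA).
Qed.

Lemma expg_inj_lt i j : i < #[a] -> j < #[a] -> a ^+ i = a ^+ j -> i = j.
Proof.
by move=> lti ltj /eqP; rewrite eq_expg_mod_order !modn_small // => /eqP.
Qed.

(** The map fixing the even powers of [a] and multiplying the odd ones by [b] carries [A] onto a
    dihedral subgroup of index 2. It preserves differences up to inversion, which a symmetric [S]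
    does not notice, and it takes [a] to [b * a]. *)
Lemma even_symmetric_not_CI (S : {set gT}) :
    ~~ odd #[a] -> S \subset A -> {in S, forall x, x^-1 \in S} -> a \in S ->
    1 \notin S ->
  ~ CI_subset S.
Proof.
move=> n_even sSA SV Sa nS1; pose N := <[a ^+ 2]>.
have memN i : (a ^+ i \in N) = ~~ odd i.
  apply/idP/idP=> [/cycleP[j]|ei].
    move/eqP; rewrite -expgM eq_expg_mod_order => /eqP/(congr1 odd).
    by rewrite !(odd_mod _ (negbTE n_even)) oddM => ->.
  by apply/cycleP; exists i./2; rewrite -expgM mul2n even_halfK.
have sNA : N \subset A by rewrite cycle_subG mem_cycle.
have outN x y : x \in A -> y \in A -> (x * y^-1 \in N) = ((x \in N) == (y \in N)).
  move=> /cycleP[i ->] /cycleP[j ->].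
  have -> : (a ^+ j)^-1 = a ^+ (j * #[a].-1).
    apply/eqP; rewrite eq_invg_mul -expgD -order_dvdn -mulnS.
    by rewrite prednK ?order_gt0 // dvdn_mull.
  rewrite -expgD !memN oddD oddM.
  have -> : odd #[a].-1.
    by have := n_even; rewrite -{1}(prednK (order_gt0 a)) /= negbK.
  by case: (odd i); case: (odd j).
pose phi x := if x \in N then x else b * x.
have phi_out x : x \in A -> (phi x \in A) = (x \in N).
  rewrite /phi; case: (boolP (x \in N)) => [Nx -> //|_ Ax].
  by rewrite groupMr // (negbTE nAb).
have mulb x : x \in A -> x * b = b * x^-1 by apply: dih_mulC.
have phiI : {in A &, injective phi}.
  move=> x y Ax Ay eqphi; have := phi_out x Ax; rewrite eqphi phi_out // => eqN.
  by move: eqphi; rewrite /phi eqN; case: ifP => // _ /mulgI.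
have phiD : {in A &, forall x y, phi y * (phi x)^-1 = phi (y * x^-1)
                             \/ phi y * (phi x)^-1 = phi (x * y^-1)}.
  move=> x y Ax Ay; rewrite /phi !outN // (eq_sym (x \in N)).
  have Ayx : y * x^-1 \in A by rewrite groupM ?groupV.
  have [Nx|nNx] := boolP (x \in N); have [Ny|nNy] := boolP (y \in N) => /=.
  - by left.
  - by left; rewrite mulgA.
  - right; rewrite invMg (dih_inv dihA nAb) mulgA mulb //.
    by rewrite invMg invgK.
  - right; rewrite invMg (dih_inv dihA nAb) mulgA -(mulgA b) -mulgA mulb //.
    by rewrite mulgA (dih_sq dihA nAb) mul1g invMg invgK.
apply: (@not_CI_of_outer S (phi @: S) (b * a)) => //.
- apply/imsetP; exists a => //; rewrite /phi -{2}[a]expg1 memN //.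
- by rewrite groupMr ?cycle_id.
- apply/imsetP=> [[x Sx]] /esym phix1; case/negP: nS1.
  have Ax := subsetP sSA _ Sx; rewrite -(phiI x 1) ?group1 //.
  by rewrite phix1 /phi group1.
exact: cayley_iso_twist phiI phiD sSA SV.
Qed.

(** For [m = 1] no symmetric set can contain [a], so the involution in [A] is exchanged for the
    reflection [b] instead. *)
Lemma even_not_DCI m : ~~ odd #[a] -> 0 < m < #[a] -> ~ has_DCI gT m.
Proof.
move=> n_even /andP[m_gt0 lt_mn] DCI; set n := #[a] in n_even lt_mn.
have n2 : (n = n./2 + n./2)%N by rewrite addnn even_halfK.
have h_lt : n./2 < n by have := n_gt2; rewrite -/n; lia.
have aV i : i <= n -> (a ^+ i)^-1 = a ^+ (n - i).
  move=> lein; apply/eqP; rewrite eq_invg_mul -expgD subnKC //.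
  by apply/eqP/expg_order.
have [m1|m_neq1] := eqVneq m 1%N.
  pose c : gT := a ^+ n./2.
  have c_neq1 : c != 1.
    by apply/eqP=> c1; have := @expg_inj_lt n./2 0 h_lt (order_gt0 a) c1; lia.
  have cV : c^-1 = c by rewrite aV ?(ltnW h_lt) //; congr (a ^+ _); lia.
  pose phi (x : gT) : gT := if x == 1 then 1 else b.
  have c2 x : x \in <[c]> -> x = 1 \/ x = c.
    case/cycleP=> i ->; rewrite -[i]odd_double_half -mul2n expgD expgM.
    have -> : c ^+ 2 = 1 by rewrite expgS expg1 -{1}cV mulVg.
    by rewrite expg1n mulg1; case: (odd i); [right|left].
  have b_neq1 : b != 1 by apply: contraNneq nAb => ->; apply: group1.
  have Ac : c \in A by apply: mem_cycle.
  suff nCI : ~ CI_subset [set c] by apply: nCI; apply: DCI; rewrite ?cards1 // inE eq_sym.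
  apply: (@not_CI_of_outer [set c] (phi @: [set c]) b).
  - by rewrite sub1set.
  - by rewrite imset_set1 inE /phi (negbTE c_neq1).
  - exact: nAb.
  - by rewrite imset_set1 inE /phi (negbTE c_neq1) eq_sym.
  - apply: (@cayley_iso_twist _ <[c]>).
    + by move=> x y /c2[->|->] /c2[->|->] //; rewrite /phi eqxx (negbTE c_neq1) => /eqP;
        rewrite ?(negbTE b_neq1) // eq_sym (negbTE b_neq1).
    + move=> x y /c2[->|->] /c2[->|->]; left; rewrite ?invg1 ?mulg1 ?mul1g ?mulgV /phi;
        rewrite ?cV ?eqxx ?(negbTE c_neq1) ?invg1 ?mulg1 ?mulgV //.
      by rewrite mul1g (dih_inv dihA nAb).
    + by rewrite sub1set cycle_id.
    + by move=> x /set1P->; rewrite cV set11.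
pose l := m./2.
have m2 : (m = odd m + (l + l))%N by rewrite addnn odd_double_half.
have ltl : l < n./2 by lia.
have l_gt0 : 0 < l by lia.
(* The exponents from 1 to [l] and their negatives, with the self-inverse exponent [n./2] added when
   [m] is odd. *)
pose X := iota 1 l ++ iota (n - l) l ++ (if odd m then [:: n./2] else [::]).
have memX i : (i \in X) = [|| 1 <= i <= l, n - l <= i < n | odd m && (i == n./2)].
  rewrite !mem_cat !mem_iota subnK; last by lia.
  by rewrite add1n; case: (odd m); rewrite ?inE.
have uniqX : uniq X.
  rewrite !cat_uniq !iota_uniq has_cat negb_or -!all_predC /=.
  apply/andP; split; first (apply/andP; split).
  - by apply/allP=> i; rewrite /= !mem_iota; lia.
  - by case: ifP => //= _; rewrite mem_iota; lia.
  - by case: ifP => //= _; rewrite mem_iota; lia.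
have ltX i : i \in X -> 0 < i < n by rewrite memX; lia.
have sizeX : size X = m.
  by rewrite !size_cat !size_iota; case: ifP m2 => _ /= m2; lia.
pose S := [set x in map (expgn a) X].
have SP x : reflect (exists2 i, i \in X & x = a ^+ i) (x \in S).
  by rewrite inE; apply: mapP.
have S1 : 1 \notin S.
  apply/SP=> [[i /ltX/andP[i_gt0 lti]] /esym a1].
  by have := @expg_inj_lt i 0 lti (order_gt0 a) a1; lia.
suff nCI : ~ CI_subset S.
  apply: nCI; apply: DCI => //.
  rewrite cardsE -sizeX -(size_map (expgn a)); apply/card_uniqP.
  rewrite map_inj_in_uniq // => i j /ltX/andP[_ lti] /ltX/andP[_ ltj].
  exact: expg_inj_lt.
apply: even_symmetric_not_CI => //.
- by apply/subsetP=> x /SP[i _ ->]; apply: mem_cycle.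
- move=> x /SP[i Xi ->]; have /andP[i_gt0 lti] := ltX i Xi.
  rewrite aV ?(ltnW lti) //; apply/SP; exists (n - i)%N => //.
  by move: Xi; rewrite !memX; lia.
- by apply/SP; exists 1%N; rewrite ?expg1 // memX l_gt0.
Qed.

End DihedralNonCI.


(** * Squaring the component in a subgroup of odd order *)

Section Doubling.

Variables (gT : finGroupType) (A Z : {group gT}) (b : gT).
Hypotheses (dihA : dihedral_over A) (sZA : Z \subset A) (oddZ : odd #|Z|).
Hypothesis nAb : b \notin A.

Definition double_in (X : {set gT}) : {set gT} :=
  (X :\: Z) :|: [set x * x | x in X :&: Z].

(** Makes membership outside [Z] insensitive to shifts by [Z], so that only differences lying in [Z]
    have to be followed exactly. *)
Definition coset_closed (X : {set gT}) : Prop :=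
  forall x z, x \in X -> x \notin Z -> z \in Z -> x * z \in X.

Let sqI : {in Z &, injective (fun x : gT => x * x)}.
Proof.
have co2 : coprime #|Z| 2 by rewrite coprime_sym coprime2n.
by move=> x y Zx Zy eqxy; apply: (can_in_inj (expgK co2)); rewrite // !expgS !expg1.
Qed.

(** [d] and [d'] stand for the difference of two vertices before and after doubling. Inside [Z]
    squaring is injective since [#|Z|] is odd; outside, coset closure absorbs the shift. *)
Lemma double_in_mem (X : {set gT}) d d' : X \subset A -> coset_closed X ->
    (d \in Z -> d' = d * d) -> (d \notin Z -> d^-1 * d' \in Z) ->
  (d \in X) = (d' \in double_in X).
Proof.
move=> sXA XZ dZ dnZ; rewrite !inE; have [Zd|nZd] := boolP (d \in Z).
  rewrite dZ // groupM //=; apply/idP/imsetP=> [Xd|[x /setIP[Xx Zx] /sqI->]] //.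
  by exists d; rewrite // inE Xd.
have Zdd' := dnZ nZd; have nZd' : d' \notin Z by rewrite -(mulKVg d d') groupMr.
rewrite nZd' [d' \in [set _ | _ in _]](negbTE _) ?orbF; last first.
  by apply: contra nZd' => /imsetP[x /setIP[_ Zx] ->]; rewrite groupM.
rewrite andTb; apply/idP/idP=> [Xd|Xd']; first by rewrite -(mulKVg d d') XZ.
by rewrite -(mulKVg d' d) XZ // -groupV invMg invgK.
Qed.

(* On each coset Zr of a transversal, the digraph isomorphism is zr |-> z^2 r. *)
Lemma doubling_iso (X Y : {set gT}) :
    X \subset A -> Y \subset A -> coset_closed X -> coset_closed Y ->
  cayley_iso (X :|: b *: Y) (double_in X :|: b *: double_in Y).
Proof.
move=> sXA sYA XZ YZ.
have cAA := dih_abelian dihA.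
pose tau (x : gT) : gT := x * (repr (Z :* x))^-1.
have tauZ x : tau x \in Z.
  rewrite /tau; case: repr_rcosetP => c Zc.
  by rewrite invMg mulKVg groupV.
have tauM x z : z \in Z -> tau (z * x) = z * tau x.
  by move=> Zz; rewrite /tau rcosetM (rcoset_id Zz) mulgA.
clearbody tau.
have AZ x : x \in Z -> x \in A by apply: subsetP.
pose h x := x * tau x.
have hA x : (h x \in A) = (x \in A) by rewrite /h (groupMr _ (AZ _ (tauZ x))).
have hD x y : x \in A -> y \in A ->
    (y * x^-1 \in Z -> h y * (h x)^-1 = (y * x^-1) * (y * x^-1))
    /\ (y * x^-1 \notin Z -> (y * x^-1)^-1 * (h y * (h x)^-1) \in Z).
  move=> Ax Ay.
  have hE : h y * (h x)^-1 = y * x^-1 * (tau y * (tau x)^-1).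
    rewrite /h invMg -!mulgA; congr (_ * _).
    have At : tau y * (tau x)^-1 \in A by rewrite AZ // groupM ?groupV.
    by rewrite mulgA cAA ?groupV.
  split=> [Zyx|_]; rewrite hE; last by rewrite mulKg groupM ?groupV.
  congr (_ * _); rewrite -{1}(mulgKV x y) tauM //.
  by rewrite -mulgA mulgV mulg1.
have memD (V : {set gT}) x y : V \subset A -> coset_closed V -> x \in A -> y \in A ->
    (y * x^-1 \in V) = (h y * (h x)^-1 \in double_in V).
  by move=> sVA VZ Ax Ay; have [] := hD x y Ax Ay; apply: double_in_mem.
have sdA (V : {set gT}) : V \subset A -> double_in V \subset A.
  move=> sVA; rewrite subUset (subset_trans (subsetDl _ _)) //=.
  apply/subsetP=> _ /imsetP[x /setIP[Vx _] ->].
  by rewrite groupM ?(subsetP sVA).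
have memA (V W : {set gT}) x : V \subset A -> W \subset A -> x \in A ->
    (x \in V :|: b *: W) = (x \in V).
  move=> sVA sWA Ax; rewrite inE orbC; case: lcosetP => // -[y Wy def_x].
  by move: Ax; rewrite def_x (groupMr _ (subsetP sWA _ Wy)) (negbTE nAb).
have memnA (V W : {set gT}) x : V \subset A -> W \subset A -> x \in A ->
    (b * x \in V :|: b *: W) = (x \in W).
  move=> sVA sWA Ax; rewrite inE mem_lcoset mulKg; case: (boolP (_ \in V)) => //.
  by move/(subsetP sVA); rewrite groupMr // (negbTE nAb).
have h_inj x y : x \in A -> y \in A -> h x = h y -> x = y.
  move=> Ax Ay eqh; have [hDZ hDn] := hD x y Ax Ay.
  have Zyx : y * x^-1 \in Z.
    apply: contraT => nZ.
    by have := hDn nZ; rewrite eqh mulgV mulg1 groupV (negbTE nZ).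
  have := hDZ Zyx; rewrite eqh mulgV => /esym; rewrite -[1]mulg1 => /sqI.
  by rewrite Zyx group1 => /(_ isT isT)/eqP; rewrite -eq_mulgV1 => /eqP.
clearbody h.
(* A reflection [b * u] goes to [b * h u], so rotations and reflections are doubled by the same
   map. *)
pose f x := if x \in A then h x else b * h (b * x).
have outM x y : x \notin A -> y \notin A -> x * y \in A by apply: dih_outer_mul.
have fA x : (f x \in A) = (x \in A).
  rewrite /f; case: (boolP (x \in A)) => [Ax|nAx]; first by rewrite hA.
  by rewrite groupMr ?hA ?outM // (negbTE nAb).
have f_inj : injective f.
  move=> x y eqf; have := fA x; rewrite eqf fA => eqA.
  move: eqf; rewrite /f eqA; case: (boolP (x \in A)) => [Ax|nAx].
    by apply: h_inj; rewrite // eqA.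
  move/mulgI => eqh; apply: (mulgI b); apply: h_inj eqh; apply: outM => //.
  by rewrite eqA.
have fb x : x \in A -> f (b * x) = b * h x.
  by move=> Ax; rewrite /f groupMr // (negbTE nAb) -(dih_outer_rep dihA x nAb).
have outE x : x \notin A -> exists2 y, y \in A & x = b * y.
  by move=> nAx; exists (b * x); [apply: outM | rewrite -(dih_outer_rep dihA x nAb)].
have bb : b * b = 1 by apply: (dih_sq dihA).
have bV : b^-1 = b by apply: (dih_inv dihA).
exists (perm f_inj) => x y; rewrite !permE /cayley_arc.
have fin u : u \in A -> f u = h u by rewrite /f => ->.
have conjb u : u \in A -> b * u * b = u^-1.
  by move=> Au; rewrite -mulgA (dih_mulC dihA nAb Au) mulgA bb mul1g.
have mulb u : u \in A -> u * b = b * u^-1 by apply: dih_mulC.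
have Ahh u v : u \in A -> v \in A -> (v * u^-1 \in A) && (h v * (h u)^-1 \in A).
  by move=> Au Av; apply/andP; split; apply: groupM; rewrite ?groupV ?hA.
have [sdX sdY] := (sdA X sXA, sdA Y sYA).
have [Ax|/outE[x' Ax' ->]] := boolP (x \in A);
  have [Ay|/outE[y' Ay' ->]] := boolP (y \in A).
- have /andP[Ayx Ahyx] := Ahh x y Ax Ay.
  by rewrite !fin // !memA //; apply: memD.
- have /andP[Ayx Ahyx] := Ahh x y' Ax Ay'.
  by rewrite (fin x Ax) fb // -(mulgA b y') -(mulgA b (h y')) !memnA //; apply: memD.
- have /andP[Axy Ahxy] := Ahh y x' Ay Ax'.
  have defE u v : u \in A -> v \in A -> v * (b * u)^-1 = b * (u * v^-1).
    move=> Au Av; rewrite invMg bV mulgA mulb ?invMg ?invgK //.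
    by rewrite groupM ?groupV.
  by rewrite (fin y Ay) fb // !defE ?hA // !memnA //; apply: memD.
have /andP[Axy Ahxy] := Ahh y' x' Ay' Ax'.
have defE u v : u \in A -> v \in A -> b * v * (b * u)^-1 = u * v^-1.
  move=> Au Av; rewrite invMg bV mulgA -(mulgA b) conjb ?invMg ?invgK //.
  by rewrite groupM ?groupV.
by rewrite !fb // !defE ?hA // !memA //; apply: memD.
Qed.

(** Cosets of [Z] are added one at a time; the successor in the bound leaves room for [Z] itself,
    which is avoided. *)
Lemma coset_closed_exists k : (k.+1 * #|Z| <= #|A|) ->
  exists2 Y : {set gT}, Y \subset A :\: Z & coset_closed Y /\ #|Y| = (k * #|Z|)%N.
Proof.
elim: k => [|k IHk] lekA.
  by exists set0; rewrite ?sub0set ?cards0 //; split=> // x z; rewrite inE.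
have [|Y sYA [YZ oY]] := IHk.
  by apply: leq_trans lekA; rewrite leq_mul2r leqnSn orbT.
have [x Ax nYx] : exists2 x, x \in A :\: Z & x \notin Y.
  apply/subsetPn; apply/negP=> /subset_leq_card; rewrite oY.
  rewrite -(leq_add2l #|A :&: Z|) cardsID (setIidPr sZA).
  by rewrite leqNgt (leq_trans _ lekA) // -mulSn ltn_mul2r cardG_gt0 ltnSn.
have [Ax' nZx] := setDP Ax.
exists (Y :|: x *: Z).
  rewrite subUset sYA; apply/subsetP=> _ /lcosetP[z Zz ->].
  by rewrite inE groupMr // nZx groupM // (subsetP sZA).
split=> [u z|].
  rewrite !inE => /orP[Yu nZu Zz|]; first by rewrite YZ.
  by rewrite !mem_lcoset => xu _ Zz; rewrite mulgA groupM ?orbT.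
rewrite cardsU oY card_lcoset (_ : Y :&: x *: Z = set0).
  by rewrite cards0 subn0 mulSn addnC.
apply/setP=> u; rewrite in_setI in_set0; apply/negP=> /andP[Yu /lcosetP[z Zz def_u]].
have /setDP[_ nZu] := subsetP sYA _ Yu.
by case/negP: nYx; rewrite -(mulgK z x) -def_u YZ ?groupV.
Qed.

End Doubling.


(** * Necessity: no square of a prime below the valency divides the order *)

Lemma subset_of_card (T : finType) (A : {set T}) r : r <= #|A| ->
  exists2 B : {set T}, B \subset A & #|B| = r.
Proof.
move=> lerA; exists [set x in take r (enum A)].
  by apply/subsetP=> x; rewrite inE => /mem_take; rewrite mem_enum.
rewrite cardsE -[RHS](size_takel (s := enum A)) -?cardE //.
by apply/card_uniqP; rewrite take_uniq ?enum_uniq.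
Qed.

(** The set {z} together with [a *: <[z]>] forces the contradiction; reflections bring the valency
    up to [m] without disturbing the doubling. *)
Lemma psquare_not_DCI (gT : finGroupType) (a b : gT) p m :
    dihedral_over <[a]> -> b \notin <[a]> -> 2 < #[a] -> odd #[a] ->
    prime p -> p ^ 2 %| #[a] -> p < m < #[a] ->
  ~ has_DCI gT m.
Proof.
move=> dihA nAb n_gt2 n_odd p_pr p2n /andP[lt_pm lt_mn] DCI.
have pn : p %| #[a] by apply: dvdn_trans p2n; rewrite dvdn_exp.
have p_odd : odd p := dvdn_odd pn n_odd.
have p_gt2 : 2 < p by rewrite odd_prime_gt2.
pose N := (#[a] %/ p)%N; have nE : #[a] = (N * p)%N by rewrite divnK.
have N_gt0 : 0 < N by have := order_gt0 a; rewrite nE; case: (N).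
have pN : p %| N by rewrite -(dvdn_pmul2r (prime_gt0 p_pr)) -nE mulnn.
pose z := a ^+ N.
have oz : #[z] = p by rewrite orderXdiv nE ?dvdn_mulr // mulKn.
have zX1 : z ^+ p = 1 by rewrite -oz expg_order.
have Az : z \in <[a]> by apply: mem_cycle.
have sZA : <[z]> \subset <[a]> by rewrite cycle_subG.
have Zmem x : x \in <[a]> -> x ^+ p = 1 -> x \in <[z]>.
  move=> Ax xp; rewrite -cycle_subG -(cardSg_cyclic (cycle_cyclic a)) ?cycle_subG //.
  by rewrite -!orderE oz order_dvdn xp.
have nZa : a \notin <[z]>.
  apply/negP=> /order_dvdG; rewrite -orderE oz => /(dvdn_trans p2n).
  by move/(dvdn_leq (prime_gt0 p_pr)); rewrite -mulnn; nia.
have z_neq1 : z != 1 by rewrite -order_gt1 oz; apply: leq_trans p_gt2.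
have oddZ : odd #|<[z]>| by rewrite -orderE oz.
have zz_neq1 : z * z != 1.
  apply/eqP=> zz1; have: #[z] %| 2 by rewrite order_dvdn expgS expg1 zz1.
  by rewrite oz => /(dvdn_leq (isT : 0 < 2)); rewrite leqNgt p_gt2.
(* [M] reflections are still needed. Full cosets outside [<[z]>] supply a multiple of [p], and the
   remainder [R] sits inside [<[z]>], where coset closure asks nothing. *)
pose M := (m - p.+1)%N.
have [|Y0 sY0 [Y0Z oY0]] := @coset_closed_exists _ <[a]> <[z]> sZA (M %/ p).
  rewrite -!orderE oz; have := leq_trunc_div M p; rewrite /M; lia.
have [|R sRZ oR] := @subset_of_card _ <[z]> (M %% p).
  by rewrite -orderE oz ltnW // ltn_mod prime_gt0.
pose Y := Y0 :|: R; pose X := z |: a *: <[z]>.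
have Y0A : Y0 \subset <[a]> := subset_trans sY0 (subsetDl _ _).
have sYA : Y \subset <[a]> by rewrite subUset Y0A (subset_trans sRZ).
have oY : #|Y| = M.
  rewrite cardsU oY0 oR (_ : Y0 :&: R = set0).
    by rewrite cards0 subn0 -orderE oz -divn_eq.
  apply/setP=> x; rewrite in_setI in_set0; apply/negP=> /andP[/(subsetP sY0)/setDP[_ nZx]].
  by move/(subsetP sRZ) => Zx; rewrite Zx in nZx.
have YZ : coset_closed <[z]> Y.
  move=> x u; rewrite !inE => /orP[Y0x nZx Zu|/(subsetP sRZ) -> //].
  by rewrite Y0Z.
have sXA : X \subset <[a]>.
  rewrite subUset sub1set Az; apply/subsetP=> _ /lcosetP[u Zu ->].
  by rewrite groupM ?cycle_id ?(subsetP sZA).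
have XZ : coset_closed <[z]> X.
  move=> x u; rewrite !inE => /orP[/eqP-> | Xx _ Zu]; first by rewrite cycle_id.
  by apply/orP; right; move: Xx; rewrite !mem_lcoset mulgA => Xx; rewrite groupM.
have XinZ u : u \in X -> u \in <[z]> -> u = z.
  rewrite !inE => /orP[/eqP //|/lcosetP[v Zv ->]]; rewrite groupMr //.
  by move=> Za; rewrite Za in nZa.
have oX : #|X| = p.+1.
  rewrite cardsU1 card_lcoset -orderE oz; case: (boolP (_ \in _)) => //.
  by move/lcosetP=> [v Zv def_z]; have := cycle_id z; rewrite {1}def_z groupMr // (negbTE nZa).
have outb (W : {set gT}) x : W \subset <[a]> -> x \in <[a]> -> x \notin b *: W.
  move=> sWA Ax; apply/lcosetP=> [[y Wy def_x]].
  by move: Ax; rewrite def_x (groupMr _ (subsetP sWA _ Wy)) (negbTE nAb).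
have sdA (V : {set gT}) : V \subset <[a]> -> double_in <[z]> V \subset <[a]>.
  move=> sVA; rewrite subUset (subset_trans (subsetDl _ _)) //=.
  apply/subsetP=> _ /imsetP[x /setIP[Vx _] ->].
  by rewrite groupM ?(subsetP sVA).
pose S := X :|: b *: Y.
pose T := double_in <[z]> X :|: b *: double_in <[z]> Y.
have T_A x : x \in T -> x \in <[a]> -> (x \in a *: <[z]>) || (x == z * z).
  rewrite /T => /setUP[Tx|Tx] Ax; last by have := outb _ x (sdA Y sYA) Ax; rewrite Tx.
  case/setUP: Tx => [/setDP[Xx nZx]|/imsetP[u /setIP[Xu Zu] ->]].
    by move: Xx; rewrite in_setU1 => /orP[/eqP xz|-> //]; rewrite xz cycle_id in nZx.
  by rewrite (XinZ u Xu Zu) eqxx orbT.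
have aZ u : u \in a *: <[z]> -> u \notin <[z]>.
  by case/lcosetP=> v Zv ->; rewrite groupMr.
have S1 : 1 \notin S.
  rewrite inE negb_or outb ?group1 // andbT !inE negb_or eq_sym z_neq1 /=.
  by apply/negP=> /aZ; rewrite group1.
have T1 : 1 \notin T.
  apply/negP=> /T_A; rewrite group1 => /(_ isT)/orP[/aZ|]; first by rewrite group1.
  by rewrite eq_sym (negbTE zz_neq1).
have oS : #|S| = m.
  rewrite cardsU oX card_lcoset oY (_ : X :&: _ = set0).
    by rewrite cards0 subn0 /M subnKC.
  apply/setP=> x; rewrite in_setI in_set0; apply/negP=> /andP[/(subsetP sXA) Ax].
  by apply/negP/outb.
have [s As sST] := DCI S S1 oS T T1 (doubling_iso dihA sZA oddZ nAb sXA sYA XZ YZ).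
have sM := AutT_mul As.
have s1 : s 1 = 1 by apply: (mulgI (s 1)); rewrite -sM !mulg1.
have sX x i : s (x ^+ i) = s x ^+ i.
  by elim: i => [|i IHi]; rewrite ?expg0 // !expgS sM IHi.
have sA x : x \in <[a]> -> s x \in <[a]> by apply: dih_Aut_cyclic.
have Sz : z \in S by rewrite inE in_setU1 eqxx.
have Sa : a \in S by rewrite inE in_setU1 lcoset_refl orbT.
have sT x : x \in S -> s x \in T by move=> Sx; rewrite -sST imset_f.
(* [s z] has p-th power 1 and so lies in [<[z]>], where [z * z] is the only rotation of [T]. *)
have sz : s z = z * z.
  have Zsz : s z \in <[z]> by rewrite Zmem ?sA // -sX zX1.
  have /orP[/aZ|/eqP //] := T_A _ (sT z Sz) (sA z Az).
  by rewrite Zsz.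
have /orP[/lcosetP[u Zu sa]|/eqP sa] := T_A _ (sT a Sa) (sA a (cycle_id a)); last first.
  by case/negP: nZa; rewrite (@perm_inj _ s a z) ?cycle_id // sa sz.
(* With [s a = a * u], applying [s] to [z = a ^+ N] gives [z * u ^+ N], which is [z] because [p]
   divides [N]; but [s z] is [z * z]. *)
case/negP: z_neq1; rewrite -(inj_eq (mulgI z)) mulg1 -sz sX sa expgMn; last first.
  by apply: (dih_abelian dihA); rewrite ?cycle_id ?(subsetP sZA).
have -> : u ^+ N = 1.
  have /dvdnP[j ->] := pN; rewrite mulnC expgM.
  have -> : u ^+ p = 1; last exact: expg1n.
  by apply/eqP; rewrite -order_dvdn -oz orderE order_dvdG.
by rewrite mulg1.
Qed.

(** * The dihedral presentation and the final assembly *)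

(** The order 2n prevents collapse: with [b] in [<[a]>] the group would have at most n elements, and
    likewise [a] cannot have order below n. *)
Lemma dihedral_presentation (gT : finGroupType) (a b : gT) n :
    2 < n -> #|[set: gT]| = n.*2 -> <[a]> <*> <[b]> = [set: gT] ->
    a ^+ n = 1 -> b ^+ 2 = 1 -> a ^ b = a^-1 ->
  [/\ dihedral_over <[a]>, b \notin <[a]> & #[a] = n].
Proof.
move=> n_gt2 oG joinG an b2 ab; have n_gt1 := ltnW n_gt2.
have defG : <[a]> * <[b]> = [set: gT].
  by rewrite -norm_joinEr // norms_cycle ab groupV cycle_id.
have nAb : b \notin <[a]>.
  apply/negP=> Ab; have: n.*2 <= n; last by rewrite -addnn; lia.
  rewrite -{1}oG -defG mulGSid ?cycle_subG // dvdn_leq ?(ltnW n_gt1) //.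
  by rewrite order_dvdn an.
have ob : #[b] = 2 by apply: nt_prime_order (group1_contra nAb).
have oa : #[a] = n.
  apply: double_inj; rewrite -muln2 -ob -oG -defG TI_cardMg //.
  by rewrite setIC prime_TIg ?cycle_subG // -orderE ob.
have outE x : x \notin <[a]> -> exists2 c, c \in <[a]> & x = c * b.
  move=> nAx; have: x \in <[a]> * <[b]> by rewrite defG inE.
  case/mulsgP=> c d Ac /cycleP[j def_d] def_x; exists c; rewrite // def_x.
  congr (_ * _); move: nAx; rewrite def_x groupMl // def_d.
  rewrite -[j]odd_double_half -mul2n expgD expgM b2 expg1n mulg1.
  by case: (odd j); rewrite ?group1 // expg1.
have bV : b^-1 = b by apply/eqP; rewrite eq_invg_mul -b2 expgS expg1.
have cb c : c \in <[a]> -> b * c = c^-1 * b.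
  by case/cycleP=> i ->; rewrite [RHS]conjgC conjVg conjXg ab expVgn invgK.
have outM x y : x \notin <[a]> -> y \notin <[a]> ->
    exists c d, [/\ c \in <[a]>, d \in <[a]>, x = c * b, y = d * b & x * y = c * d^-1].
  move=> /outE[c Ac ->] /outE[d Ad ->]; exists c, d; split=> //.
  by rewrite -mulgA (mulgA b) cb // -mulgA -{2}bV mulgV mulg1.
split=> //; split=> [|x nAx|x y nAx nAy]; first exact: cycle_cyclic.
  have [c [d [_ _ xc xd ->]]] := outM x x nAx nAx.
  by move: xd; rewrite xc => /mulIg->; rewrite mulgV.
by have [c [d [Ac Ad _ _ ->]]] := outM x y nAx nAy; rewrite groupM ?groupV.
Qed.

Lemma dihedral_group_structure n : 2 < n ->
  exists a b : 'D_(n.*2), [/\ dihedral_over <[a]>, b \notin <[a]> & #[a] = n].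
Proof.
move=> n_gt2; have n_gt1 := ltnW n_gt2.
have oG : #|[set: 'D_(n.*2)]| = n.*2 by exact: card_dihedral.
have: [set: 'D_(n.*2)] \homg Grp (x : y : x ^+ n, y ^+ 2, x ^ y = x^-1).
  by rewrite -(Grp_dihedral n_gt1) homg_refl.
case/existsP=> -[a b] /= /eqP[joinG an b2 ab].
by exists a, b; apply: dihedral_presentation.
Qed.


(* 'D_(n.*2) is MathComp's dihedral group of order 2n (extremal.v). *)
Theorem theorem1p1 (n : nat) : 2 < n ->
  (forall m : nat, 1 <= m <= n.-1 -> has_DCI ('D_(n.*2))%type m ->
     odd n /\
     (forall p : nat, prime p -> p %| n -> p.+1 <= m ->
        forall P : {group 'D_(n.*2)}, P \in 'Syl_p([set: 'D_(n.*2)]) ->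
          P \isog Zp p))
  /\
  (forall q k : nat, prime q -> n = (q ^ k)%N ->
     forall m : nat, 1 <= m <= n.-1 ->
       (has_DCI ('D_(n.*2))%type m <-> odd q /\ (n = q \/ m <= q))).
Proof.
move=> n_gt2; have [a [b [dihA nAb oa]]] := dihedral_group_structure n_gt2.
have a_gt2 : 2 < #[a] by rewrite oa.
have DCI_odd m : 1 <= m <= n.-1 -> has_DCI ('D_(n.*2))%type m -> odd n.
  move=> m_n; apply: contraPT => n_even.
  by apply: (even_not_DCI dihA nAb a_gt2); rewrite oa //; lia.
have DCI_p2 m p : 1 <= m <= n.-1 -> has_DCI ('D_(n.*2))%type m -> prime p -> p < m ->
    ~~ (p ^ 2 %| n).
  move=> m_n DCI p_pr lt_pm; have n_odd := DCI_odd m m_n DCI; apply/negP=> p2n.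
  apply: (@psquare_not_DCI _ a b p m) DCI; rewrite ?oa //; lia.
split=> [m m_n DCI|q k q_pr def_n m m_n].
  have n_odd := DCI_odd m m_n DCI; split=> // p p_pr pn lt_pm P; rewrite inE => sylP.
  have n_gt0 : 0 < n by lia.
  have p_neq2 : p != 2.
    by apply: contraTneq n_odd => p2; rewrite -dvdn2 -p2.
  have oP : #|P| = p.
    (* As [p] is odd, the order of [P] is the p-part of [n], which is divisible by [p] but not by
       its square. *)
    rewrite (card_Hall sylP) p_part.
    have -> : #|[set: 'D_(n.*2)]| = n.*2 by exact: card_dihedral (ltnW n_gt2).
    rewrite -mul2n lognM // (_ : logn p 2 = 0%N) ?add0n; last first.
      by rewrite logn_prime // (negbTE p_neq2).
    have := DCI_p2 m p m_n DCI p_pr lt_pm; rewrite pfactor_dvdn // -ltnNge => lt2.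
    have: 0 < logn p n by rewrite logn_gt0 mem_primes p_pr n_gt0.
    by case: (logn p n) lt2 => [|[|]].
  by rewrite isog_cyclic_card ?prime_cyclic ?oP // card_Zp ?prime_gt0 //= Zp_cyclic eqxx.
split=> [DCI|[q_odd le_mq]].
  have := DCI_odd m m_n DCI; rewrite {1}def_n oddX => /orP[/eqP k0|q_odd].
    by move: n_gt2; rewrite def_n k0.
  split=> //; case: (leqP m q) => [|lt_qm]; [by right | left].
  have := DCI_p2 m q m_n DCI q_pr lt_qm; rewrite {1}def_n.
  case: k def_n => [|[|k]] def_n; first by move: n_gt2; rewrite def_n.
    by rewrite def_n expn1.
  by rewrite dvdn_exp2l.
(* When [n = q], the bound [m <= n.-1] already gives [m <= q]. *)
have leq_mq : m <= q by case: le_mq => // eq_nq; lia.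
have pA : q.-group <[a]> by rewrite /pgroup -orderE oa def_n pnatX pnat_id.
move=> S nS1 oS; apply: (dih_small_CI dihA pA q_pr q_odd nS1).
by rewrite oS.
Qed.
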